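(* Let $0 \leq \beta \leq 3$, $0 \leq \alpha \leq 2$, and $0 < \delta < 1$. Let $P$ be a $( \delta, \beta, K_{\beta,P,\delta})$-set of $\delta$-neighbourhoods of circles in the plane, of radii between 1 and 2. Let $\mathbb{T}$ be a $( \delta, \alpha, K_{\alpha, \mathbb{T}, \delta})$-set of $\delta$-discs in the plane. If $\alpha + \beta \leq 4$, then for any $\epsilon >0$, \[ I(P, \mathbb{T}) \leq C_{\epsilon} \delta^{-\epsilon} \delta^{-1} K_{\beta,P,\delta}^{1/2} K_{\alpha,\mathbb{T},\delta}^{1/2} |P|^{1/2} |\mathbb{T}|^{1/2}. \] If $\alpha + \beta > 4$, then for any $\epsilon >0$, \[ I(P, \mathbb{T}) \leq C_{\epsilon} \delta^{-\epsilon} \delta^{-2\lambda} K_{\beta,P,\delta}^{\lambda} K_{\alpha,\mathbb{T},\delta}^{\lambda} |P|^{1-\lambda} |\mathbb{T}|^{1-\lambda}, \] where $\lambda = \frac{1}{\alpha+\beta-2} < 1/2$. Here $C_\epsilon$ is a constant independent of $\delta$, $P$ and $\mathbb{T}$.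
   Context: All families are finite and $|\cdot|$ denotes cardinality. If $\mathbb{T}$ is a family of $\delta$-balls (balls of radius $\delta$; discs in the plane) in a Euclidean space and $\alpha \geq 0$, then $K_{\alpha,\mathbb{T},\delta}$ denotes the smallest constant such that for every $r \geq \delta$ and every ball $B_r$ of radius $r$, \[ |\{ D \in \mathbb{T} : D \cap B_r \neq \emptyset \}| \leq K_{\alpha,\mathbb{T},\delta} \left( \frac{r}{\delta} \right)^{\alpha}, \] and $\mathbb{T}$ is then called a $(\delta,\alpha,K_{\alpha,\mathbb{T},\delta})$-set. If $P$ is a family of $\delta$-neighbourhoods of circles in the plane and $\beta \geq 0$, then $K_{\beta,P,\delta}$ is defined to be $K_{\beta,\Phi(P),\delta}$, where $\Phi$ sends the $\delta$-neighbourhood of the circle centred at $x \in \mathbb{R}^2$ of radius $r>0$ to the $\delta$-ball in $\mathbb{R}^3$ centred at $(x,r)$; $P$ is then called a $(\delta,\beta,K_{\beta,P,\delta})$-set. The number of incidences is $I(P,\mathbb{T}) = |\{ (B,T) \in P \times \mathbb{T} : B \cap T \neq \emptyset \}|$. *)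

(* Defs.v *)
From mathcomp Require Import all_boot all_order all_algebra.
From mathcomp Require Import finmap.
From mathcomp Require Import all_classical all_reals all_analysis.

Set Implicit Arguments.
Unset Strict Implicit.
Unset Printing Implicit Defensive.

Import Order.TTheory GRing.Theory Num.Theory.

Local Open Scope classical_set_scope.
Local Open Scope ring_scope.

(* The library norm on ['rV[R]_n] is the sup norm, hence a Euclidean one here. *)
Definition enorm (R : realType) (n : nat) (v : 'rV[R]_n) : R :=
  Num.sqrt (\sum_i v 0 i ^+ 2).

(* Balls and neighbourhoods are open throughout. *)
Definition eball (R : realType) (n : nat) (x : 'rV[R]_n) (r : R) :
    set 'rV[R]_n :=
  [set y | enorm (y - x) < r].

Definition circle (R : realType) (x : 'rV[R]_2) (r : R) : set 'rV[R]_2 :=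
  [set y | enorm (y - x) = r].

Definition nbhd_of (R : realType) (n : nat) (delta : R) (A : set 'rV[R]_n) :
    set 'rV[R]_n :=
  [set y | exists2 z, A z & enorm (y - z) < delta].

(* A family is a set of subsets of the space. *)
Definition ball_family (R : realType) (n : nat) (delta : R)
    (TT : set (set 'rV[R]_n)) : Prop :=
  forall D, TT D -> exists x, D = eball x delta.

Definition circle_nbhd_family (R : realType) (delta : R)
    (P : set (set 'rV[R]_2)) : Prop :=
  forall B, P B ->
    exists x r, [/\ 1 <= r, r <= 2 & B = nbhd_of delta (circle x r)].

(* [fset_set] is empty on infinite sets: only meaningful on finite [A]. *)
Definition realcard (R : realType) (T : choiceType) (A : set T) : R :=
  #|` fset_set A|%:R.
Arguments realcard R {T} A.

Definition spacing_bound (R : realType) (n : nat) (alpha : R)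
    (TT : set (set 'rV[R]_n)) (delta K : R) : Prop :=
  forall (r : R) (c : 'rV[R]_n), delta <= r ->
    realcard R [set D | TT D /\ D `&` eball c r !=set0]
      <= K * (r / delta) `^ alpha.

(* The infimum is attained for a finite family: see [spacing_const_least]. *)
Definition spacing_const (R : realType) (n : nat) (alpha : R)
    (TT : set (set 'rV[R]_n)) (delta : R) : R :=
  inf [set K | spacing_bound alpha TT delta K].

(* The image of [P] under the map sending the delta-neighbourhood of the circle
   of centre [x] and radius [r] to the delta-ball of centre [(x, r)]. For a
   given [delta > 0] the neighbourhood determines [x] (its centre of symmetry)
   and [r + delta] (its outer radius), so this is the graph of a function. *)
Definition Phi (R : realType) (delta : R) (P : set (set 'rV[R]_2)) :
    set (set 'rV[R]_(2 + 1)) :=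
  [set D | exists x r, [/\ 0 < r, P (nbhd_of delta (circle x r))
                         & D = eball (row_mx x r%:M) delta]].

Definition circle_spacing_const (R : realType) (beta : R)
    (P : set (set 'rV[R]_2)) (delta : R) : R :=
  spacing_const beta (Phi delta P) delta.

Definition incidences (R : realType) (P TT : set (set 'rV[R]_2)) : R :=
  realcard R [set BT | [/\ P BT.1, TT BT.2 & BT.1 `&` BT.2 !=set0]].

Lemma spacing_const_least (R : realType) (n : nat) (alpha delta : R)
    (TT : set (set 'rV[R]_n)) :
  finite_set TT -> 0 <= alpha -> 0 < delta ->
  spacing_bound alpha TT delta (spacing_const alpha TT delta) /\
  forall K, spacing_bound alpha TT delta K -> spacing_const alpha TT delta <= K.
Proof.
move=> fT a0 d0.
have lb0 : lbound [set K | spacing_bound alpha TT delta K] 0.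
  move=> K /(_ delta 0 (lexx _)) /=.
  rewrite divff ?gt_eqF// powR1 mulr1; exact: le_trans (ler0n _ _).
have ne : [set K | spacing_bound alpha TT delta K] !=set0.
  exists (realcard R TT) => r c dr.
  rewrite -[X in X <= _]mulr1; apply: ler_pM; rewrite ?ler0n ?ler01//.
    rewrite ler_nat; apply: fsubset_leq_card.
    rewrite -fset_set_sub//; first by move=> D [].
    by apply: sub_finite_set fT => D [].
  have r1 : 1 <= r / delta by rewrite ler_pdivlMr// mul1r.
  by rewrite -(powRr0 (r / delta)); apply: ler_powR.
split; last by move=> K HK; apply: ge_inf => //; exists 0.
move=> r c dr.
have p0 : 0 < (r / delta) `^ alpha.
  by apply: powR_gt0; rewrite divr_gt0// (lt_le_trans d0).
rewrite -ler_pdivrMr//; apply: lb_le_inf => // K HK.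
by rewrite ler_pdivrMr//; apply: HK.
Qed.

(* Main.v *)
(** With t = |x - y|^2 - r^2, the circle (x, r) and the disc at y are incident
    only if |t| <= 12 delta, and t = th(y) - 2 x.y - z with z = r^2 - |x|^2 is
    affine in (x, z).  Let N_rho count the pairs with |t| <= rho.  The key
    estimate is a high-low inequality, for a large constant D,
      D N_rho <= N_(300 D rho)
                 + C_D rho^-1 log(1/rho) (a b |P| |T|)^(1/2),
    where a and b bound the number of discs and of circles in a rho-cell.  It
    comes from expanding the second moment, over a grid of parameters (x, z),
    of the sum over y of psi(t / rho), where psi = D 1_[0,1) - 1_[0,D) has mean
    zero.  Summing over z gives the autocorrelation G of psi at
    s = th(y) - th(y') - 2 x.(y - y'); since G has mean zero and s is affine
    in x, summation by parts in x against a tent function shows that the kernel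
    decays like |y - y'|^-2, which is summable up to a logarithm over a set of
    rho-separated points of the plane.  Iterating over the scales
    12 delta (300 D)^k, with D large enough in terms of eps, and stopping at
    scale 1 or at the scale where the low and the high parts balance, gives the
    two bounds. *)

Require Import Defs.
From mathcomp Require Import all_boot all_order all_algebra.
From mathcomp Require Import finmap.
From mathcomp Require Import all_classical all_reals all_analysis.
From mathcomp Require Import zify ring lra.

Set Implicit Arguments.
Unset Strict Implicit.
Unset Printing Implicit Defensive.

Import Order.TTheory GRing.Theory Num.Theory.

Local Open Scope ring_scope.

(** * Windows and their autocorrelation *)

(** The threshold alpha + beta = 4 is the sign of one exponent. With q = 300 D, the high part at
    scale 12 delta q^k is, up to constants, a logarithm and factors independent of k, delta^-1
    (q^k)^((alpha + beta) / 2 - 1), and unrolling the recursion divides it by D^k. Since D^k = q^k /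
    300^k, what remains is 300^k delta^-1 (q^k)^((alpha + beta) / 2 - 2): bounded along the scales
    when alpha + beta <= 4, dominated by the coarsest scale otherwise. The loss 300^k is harmless
    because D satisfies 300 <= q^eps, whence 300^k <= (q^k)^eps <= delta^-eps.

    Neither family is confined to a bounded region, while cells in (x, z) are comparable with cells
    in (x, r) only for bounded x. Each circle is therefore replicated over the nearby unit squares,
    and the square is carried as a key through the second moment, so that Cauchy-Schwarz is applied
    once to all squares together.

    The high-low inequality is proved over the integers, where the primitive of G telescopes exactly
    and the second moment is a finite sum. *)

Definition window (D W u : int) : int :=
  (if (0 <= u) && (u < W) then D else 0) -
  (if (0 <= u) && (u < D * W) then 1 else 0).

(** The primitive of [window] that vanishes at 0. The total mass D * W - D * W of [window] being
    zero, it vanishes again from D * W on; this compact support is the form in which the mean-zero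
    property is used. *)
Definition window_prim (D W u : int) : int :=
  D * Num.max 0 (Num.min u W) - Num.max 0 (Num.min u (D * W)).

Lemma window_primS (D W u : int) : 1 <= D -> 0 <= W ->
  window_prim D W (u + 1) - window_prim D W u = window D W u.
Proof.
move=> D1 W0; rewrite /window_prim /window.
have VW : W <= D * W by nia.
have [V VE] : exists V : int, V = D * W by exists (D * W).
rewrite -VE in VW *.
have [u0|u0] : u < 0 \/ 0 <= u by lia.
  have -> : Num.max 0 (Num.min (u + 1) W) = 0 by lia.
  have -> : Num.max 0 (Num.min u W) = 0 by lia.
  by rewrite /= ?mulr0; do 2?(case: ifP => ?); lia.
have [uW|uW] : u < W \/ W <= u by lia.
  have -> : Num.max 0 (Num.min (u + 1) W) = u + 1 by lia.
  have -> : Num.max 0 (Num.min u W) = u by lia.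
  by rewrite /= ?mulr0; do 2?(case: ifP => ?); lia.
have -> : Num.max 0 (Num.min (u + 1) W) = W by lia.
have -> : Num.max 0 (Num.min u W) = W by lia.
by rewrite /= ?mulr0; do 2?(case: ifP => ?); lia.
Qed.

Lemma window_prim_out (D W u : int) : 1 <= D -> 0 <= W ->
  (u <= 0) || (D * W <= u) -> window_prim D W u = 0.
Proof.
move=> D1 W0 hu; rewrite /window_prim.
have VW : W <= D * W by nia.
case/orP: hu => hu.
  have -> : Num.max 0 (Num.min u W) = 0 by lia.
  have -> : Num.max 0 (Num.min u (D * W)) = 0 by lia.
  by rewrite mulr0 subrr.
have -> : Num.max 0 (Num.min u W) = W by lia.
have -> : Num.max 0 (Num.min u (D * W)) = D * W by lia.
by rewrite subrr.
Qed.

Lemma window_prim_bound (D W u : int) : 1 <= D -> 0 <= W ->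
  `|window_prim D W u| <= D * W.
Proof.
move=> D1 W0; rewrite /window_prim.
have VW : W <= D * W by nia.
have [h1 h2] : 0 <= Num.max 0 (Num.min u W) /\ Num.max 0 (Num.min u W) <= W by lia.
have [h3 h4] : 0 <= Num.max 0 (Num.min u (D * W)) /\ Num.max 0 (Num.min u (D * W)) <= D * W by lia.
have : 0 <= D * Num.max 0 (Num.min u W) <= D * W by nia.
lia.
Qed.

Lemma window_bound (D W u : int) : 1 <= D -> `|window D W u| <= D.
Proof. by move=> D1; rewrite /window; case: ifP; case: ifP; lia. Qed.

Lemma window_out (D W u : int) : 1 <= D -> 0 <= W ->
  (u < 0) || (D * W <= u) -> window D W u = 0.
Proof.
move=> D1 W0 hu; rewrite /window.
have VW : W <= D * W by nia.
by do 2?(case: ifP => ?); lia.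
Qed.

(** A step function with jumps only at 0, W and D * W, each of size at most D. The bound is kept as
    a sum of indicators so that summing over shifts counts each jump at most once. *)
Lemma window_lip (D W u : int) : 1 <= D -> 0 <= W ->
  `|window D W (u + 1) - window D W u| <=
  D * ((u == -1)%:R + (u == W - 1)%:R + (u == D * W - 1)%:R).
Proof.
move=> D1 W0; rewrite /window.
have VW : W <= D * W by nia.
have [V VE] : exists V : int, V = D * W by exists (D * W).
rewrite -VE in VW *.
case: (u =P -1) => e1; case: (u =P W - 1) => e2; case: (u =P V - 1) => e3;
 rewrite /= ?mulr1n ?mulr0n; by do 4?(case: ifP => ?); nia.
Qed.

Definition autocorr (D W : nat) (u : int) : int :=
  \sum_(z < D * W) window D W (u + z%:Z) * window D W z%:Z.

(** Only one of the two factors is integrated: this gives a primitive of [autocorr] that still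
    vanishes for |u| >= D * W. *)
Definition autocorr_prim (D W : nat) (u : int) : int :=
  \sum_(z < D * W) window_prim D W (u + z%:Z) * window D W z%:Z.

Section Autocorrelation.
Variables D W : nat.
Hypothesis D1 : (0 < D)%N.
Let V := (D * W)%N.
Let D1' : 1 <= D%:Z.
Proof. lia. Qed.
Let W0' : 0 <= W%:Z.
Proof. exact: lez_nat. Qed.

Lemma autocorr_primS u :
  autocorr_prim D W (u + 1) - autocorr_prim D W u = autocorr D W u.
Proof.
rewrite /autocorr_prim /autocorr -sumrB; apply: eq_bigr => z _.
by rewrite -mulrBl [u + 1 + _]addrAC window_primS.
Qed.

Lemma autocorr_prim_out u : V%:Z <= `|u| -> autocorr_prim D W u = 0.
Proof.
move=> hu; apply: big1 => z _.
by rewrite window_prim_out ?mul0r//; move: (ltn_ord z) hu; rewrite /V PoszM; lia.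
Qed.

Lemma autocorr_out u : V%:Z <= `|u| -> autocorr D W u = 0.
Proof.
move=> hu; apply: big1 => z _.
by rewrite window_out ?mul0r//; move: (ltn_ord z) hu; rewrite /V PoszM; lia.
Qed.

Lemma ler_norm_sum_const (n : nat) (F : nat -> int) (c : int) :
  (forall i, (i < n)%N -> `|F i| <= c) -> `|\sum_(i < n) F i| <= n%:Z * c.
Proof.
move=> h; apply: le_trans (ler_norm_sum _ _ _) _.
apply: (@le_trans _ _ (\sum_(i < n) c)); first by apply: ler_sum => i _; exact: h.
by rewrite sumr_const card_ord -mulr_natl natz.
Qed.

Lemma autocorr_bound u : `|autocorr D W u| <= V%:Z * (D%:Z * D%:Z).
Proof.
apply: (ler_norm_sum_const (F := fun z : nat => window D W (u + z%:Z) * window D W z%:Z)) => z _.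
by rewrite normrM ler_pM// window_bound.
Qed.

Lemma autocorr_prim_bound u : `|autocorr_prim D W u| <= V%:Z * (V%:Z * D%:Z).
Proof.
apply: (ler_norm_sum_const (F := fun z : nat => window_prim D W (u + z%:Z) * window D W z%:Z)) => z _.
by rewrite normrM ler_pM// ?window_bound// /V PoszM window_prim_bound.
Qed.

Lemma sum_eq_shift (n : nat) (u a : int) :
  \sum_(z < n) (u + z%:Z == a)%:R <= 1 :> int.
Proof.
have h : forall z : nat, (u + z%:Z == a) = (u + z == a) by [].
have [hz|hz] := boolP [exists z : 'I_n, u + z%:Z == a]; last first.
  rewrite big1// => z _; case: eqP => // e.
  by move/existsP: hz; case; exists z; apply/eqP.
move/existsP: hz => [z0 /eqP e0].
rewrite (bigD1 z0)//= e0 eqxx big1 ?addr0// => z /eqP nz.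
by case: eqP => // e; case: nz; apply: val_inj => /=; lia.
Qed.

(** The bound has no factor D * W: as z varies, u + z meets each of the three jumps of [window] at
    most once, and each meeting costs at most D * D. *)
Lemma autocorr_lip u : `|autocorr D W (u + 1) - autocorr D W u| <= 3 * (D%:Z * D%:Z).
Proof.
rewrite /autocorr -sumrB; apply: le_trans (ler_norm_sum _ _ _) _.
apply: (@le_trans _ _ (\sum_(z < V) (D%:Z * D%:Z) *
   ((u + z%:Z == -1)%:R + (u + z%:Z == W%:Z - 1)%:R + (u + z%:Z == D%:Z * W - 1)%:R))).
  apply: ler_sum => z _; rewrite -mulrBl normrM mulrC -mulrA ler_pM//.
    exact: window_bound.
  by rewrite [u + 1 + _]addrAC; apply: window_lip.
rewrite -mulr_sumr [leRHS]mulrC ler_wpM2l ?mulr_ge0//.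
rewrite !big_split /=.
by apply: (@le_trans _ _ (1 + 1 + 1)) => //; rewrite !lerD// sum_eq_shift.
Qed.

Lemma autocorr_lipn u (n : nat) :
  `|autocorr D W (u + n%:Z) - autocorr D W u| <= 3 * (D%:Z * D%:Z) * n%:Z.
Proof.
elim: n => [|n IH]; first by rewrite addr0 subrr normr0 mulr0.
have := autocorr_lip (u + n%:Z); rewrite -addrA -PoszD addn1 => h.
have -> : 3 * (D%:Z * D%:Z) * n.+1%:Z = 3 * (D%:Z * D%:Z) + 3 * (D%:Z * D%:Z) * n%:Z.
  by rewrite intS; ring.
apply: le_trans (lerD h IH); apply: le_trans (ler_normD _ _).
by rewrite addrA subrK.
Qed.

(** A first-order Taylor expansion of the primitive; the Lipschitz bound on [autocorr] makes the
    remainder quadratic in n. *)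
Lemma autocorr_prim_approx u (n : nat) :
  `|autocorr_prim D W (u + n%:Z) - autocorr_prim D W u - n%:Z * autocorr D W u|
   <= 3 * (D%:Z * D%:Z) * n%:Z * n%:Z.
Proof.
elim: n => [|n IH]; first by rewrite addr0 subrr mul0r subr0 normr0 mulr0.
have h1 := autocorr_primS (u + n%:Z).
have h2 := autocorr_lipn u n.
rewrite -addrA -PoszD addn1 in h1.
rewrite -[leRHS]/(_ * n.+1%:Z) -[n.+1]addn1 !PoszD in h1 *.
set a := autocorr_prim _ _ _ in h1 *; set b := autocorr_prim _ _ _ in h1 IH *.
set c := autocorr_prim _ _ _ in h1 IH *.
have -> : a - c - (n%:Z + 1) * autocorr D W u =
  (autocorr D W (u + n%:Z) - autocorr D W u) + (b - c - n%:Z * autocorr D W u).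
  by rewrite -h1; ring.
apply: le_trans (ler_normD _ _) _; apply: le_trans (lerD h2 IH) _.
rewrite -subr_ge0; set X := (X in 0 <= X).
have -> : X = 3 * (D%:Z * D%:Z) * (n%:Z + 1) by rewrite /X; ring.
by rewrite !mulr_ge0.
Qed.
End Autocorrelation.

Lemma count_progression (c : nat) (t Y : int) (N : nat) :
  (0 < c)%N -> 0 <= Y ->
  c%:Z * \sum_(X < N) ((- Y < t + c%:Z * X%:Z) && (t + c%:Z * X%:Z < Y))%:R
    <= 2 * Y + c%:Z.
Proof.
move=> c0 Y0.
(* The induction needs a bound that knows how far the progression has come: the count is limited by
   the distance t + c * N + Y travelled beyond -Y, until the whole interval has been crossed. *)
suff h : c%:Z * \sum_(X < N) ((- Y < t + c%:Z * X%:Z) && (t + c%:Z * X%:Z < Y))%:R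
    <= Num.max 0 (Num.min (t + c%:Z * N%:Z + Y) (2 * Y + c%:Z)).
  by apply: le_trans h _; lia.
elim: N => [|N IH]; first by rewrite big_ord0 mulr0; lia.
rewrite big_ord_recr /= mulrDr.
have e : c%:Z * N.+1%:Z = c%:Z * N%:Z + c%:Z by rewrite intS; ring.
rewrite e.
move: (\sum_(X < N) _) IH => S IH.
by case: (boolP (_ && _)) => /= hb; rewrite ?mulr0 ?mulr1; lia.
Qed.

Lemma abel_sum (chi h : nat -> int) (N : nat) : chi 0%N = 0 ->
  \sum_(X < N) chi X * (h X.+1 - h X) =
  chi N * h N - \sum_(X < N) (chi X.+1 - chi X) * h X.+1.
Proof.
move=> c0; elim: N => [|N IH]; first by rewrite !big_ord0 c0 mul0r subr0.
by rewrite !big_ord_recr /= IH; ring.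
Qed.

(* [c * autocorr] is replaced by a difference of its primitive, which telescopes
   along the progression; summation by parts then gains a factor [c] from the
   slow variation of [chi]. *)
Lemma autocorr_progression (D W N : nat) (chi : nat -> int) (c : nat) (t : int) :
  (0 < D)%N -> (0 < c)%N -> (c <= D * W)%N ->
  chi 0%N = 0 -> chi N = 0 ->
  (forall X, (X < N)%N -> `|chi X.+1 - chi X| <= 1) ->
  (forall X, (X <= N)%N -> 0 <= chi X <= N%:Z) ->
  c%:Z ^+ 2 * `|\sum_(X < N.+1) chi X * autocorr D W (t + c%:Z * X%:Z)| <=
  5 * (D * W)%:Z * ((D * W)%:Z ^+ 2 * D%:Z + 3 * N%:Z * D%:Z ^+ 2 * c%:Z ^+ 2).
Proof.
move=> D0 c0 cV chi0 chiN lip bnd.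
set V := (D * W)%N in cV *.
pose u X := t + c%:Z * X%:Z.
have uS X : u X.+1 = u X + c%:Z by rewrite /u intS; ring.
pose H X := autocorr_prim D W (u X).
(* Beyond the margin c, both u X and u (X + 1) lie outside (-V, V), where [H] and [autocorr]
   vanish. *)
pose ind X : int := ((- (V%:Z + c%:Z) < u X) && (u X < V%:Z + c%:Z))%:R.
pose K := \sum_(X < N.+1) ind X.
have cK : c%:Z * K <= 5 * V%:Z.
  have h : c%:Z * K <= 2 * (V%:Z + c%:Z) + c%:Z.
    by apply: count_progression => //; rewrite -PoszD.
  by apply: le_trans h _; lia.
have K0 : 0 <= K by apply: sumr_ge0 => X _; rewrite /ind ler0n.
have A1 : `|\sum_(X < N.+1) chi X * (H X.+1 - H X)| <= K * (V%:Z ^+ 2 * D%:Z).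
  rewrite big_ord_recr /= chiN mul0r addr0 abel_sum// chiN mul0r sub0r normrN.
  rewrite /K big_ord_recr /= mulrDl -[leLHS]addr0 lerD//; last first.
    by rewrite !mulr_ge0// /ind ler0n.
  rewrite mulr_suml; apply: le_trans (ler_norm_sum _ _ _) _.
  apply: ler_sum => X _; rewrite normrM /ind.
  have [uV|uV] : V%:Z <= `|u X.+1| \/ `|u X.+1| < V%:Z by lia.
    rewrite /H autocorr_prim_out// normr0 mulr0 !mulr_ge0// ler0n.
  have -> : (- (V%:Z + c%:Z) < u X) && (u X < V%:Z + c%:Z) by rewrite uS in uV; lia.
  apply: ler_pM => //; first exact: lip.
  by apply: le_trans (autocorr_prim_bound _ D0 _) _; rewrite expr2 mulrA.
(* The discretisation error, for which only the size N of [chi] is available; it becomes the term 3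
   N D^2 c^2 of the conclusion. *)
have A2 : `|\sum_(X < N.+1) chi X * (H X.+1 - H X - c%:Z * autocorr D W (u X))|
    <= K * (3 * N%:Z * D%:Z ^+ 2 * c%:Z ^+ 2).
  rewrite mulr_suml; apply: le_trans (ler_norm_sum _ _ _) _.
  apply: ler_sum => X _; rewrite normrM /ind.
  have [c1 c2] : 0 <= chi X /\ chi X <= N%:Z.
    by apply/andP; apply: bnd; rewrite -ltnS.
  have [uV|uV] : V%:Z + c%:Z <= `|u X| \/ `|u X| < V%:Z + c%:Z by lia.
    have -> : H X.+1 = 0 by rewrite /H uS autocorr_prim_out// -/V; lia.
    have -> : H X = 0 by rewrite /H autocorr_prim_out// -/V; lia.
    rewrite autocorr_out//; last by rewrite -/V; lia.
    rewrite mulr0 !subrr normr0 mulr0 !mulr_ge0// ler0n.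
  have -> : (- (V%:Z + c%:Z) < u X) && (u X < V%:Z + c%:Z) by lia.
  rewrite mul1r; apply: le_trans (_ : N%:Z * (3 * (D%:Z * D%:Z) * c%:Z * c%:Z) <= _).
    apply: ler_pM => //; first by rewrite ger0_norm.
    by rewrite /H uS autocorr_prim_approx.
  by rewrite le_eqVlt; apply/orP; left; apply/eqP; ring.
have e : c%:Z * (\sum_(X < N.+1) chi X * autocorr D W (u X)) =
   \sum_(X < N.+1) chi X * (H X.+1 - H X) -
   \sum_(X < N.+1) chi X * (H X.+1 - H X - c%:Z * autocorr D W (u X)).
  rewrite -sumrB mulr_sumr; apply: eq_bigr => X _; ring.
have B : c%:Z * `|\sum_(X < N.+1) chi X * autocorr D W (u X)| <=
    K * (V%:Z ^+ 2 * D%:Z + 3 * N%:Z * D%:Z ^+ 2 * c%:Z ^+ 2).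
  rewrite -[X in X * _ <= _]ger0_norm// -normrM e.
  by apply: le_trans (ler_normB _ _) _; rewrite mulrDr lerD.
rewrite expr2 -mulrA; apply: le_trans (ler_wpM2l _ B) _ => //.
rewrite [leLHS]mulrA; apply: ler_wpM2r => //.
Qed.

(** * The kernel of the high part *)

Ltac nonneg := repeat first [done | exact: sqr_ge0 | apply: addr_ge0 | apply: mulr_ge0 | apply: exprn_ge0].

(** Zero at both ends, so that summation by parts leaves no boundary term; it changes by at most 1
    per step, and is at least N / 3 on the middle third, where the circles will be placed. *)
Definition tent (N : nat) (X : nat) : int := Num.min X%:Z (N%:Z - X%:Z).

Lemma tent_bound N X : (X <= N)%N -> 0 <= tent N X <= N%:Z.
Proof. by rewrite /tent; lia. Qed.

Lemma tent_rev N X : (X <= N)%N -> tent N (N - X) = tent N X.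
Proof. by rewrite /tent; lia. Qed.

(** A negative step becomes positive when the progression is run backwards, which leaves the tent
    unchanged. *)
Lemma tent_autocorr_progression (D W N : nat) (c t : int) :
  (0 < D)%N -> c != 0 -> `|c| <= (D * W)%:Z ->
  c ^+ 2 * `|\sum_(X < N.+1) tent N X * autocorr D W (t + c * X%:Z)| <=
  5 * (D * W)%:Z * ((D * W)%:Z ^+ 2 * D%:Z + 3 * N%:Z * D%:Z ^+ 2 * c ^+ 2).
Proof.
move=> D0 c0 cV.
have pos (n : nat) s : (0 < n)%N -> (n <= D * W)%N ->
   n%:Z ^+ 2 * `|\sum_(X < N.+1) tent N X * autocorr D W (s + n%:Z * X%:Z)| <=
   5 * (D * W)%:Z * ((D * W)%:Z ^+ 2 * D%:Z + 3 * N%:Z * D%:Z ^+ 2 * n%:Z ^+ 2).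
  move=> n0 nV; apply: autocorr_progression => //.
  - by rewrite /tent; lia.
  - by rewrite /tent; lia.
  - by move=> X hX; rewrite /tent; lia.
  - exact: tent_bound.
case: c c0 cV => n c0 cV; first by apply: pos; lia.
rewrite NegzE in c0 cV *.
rewrite sqrrN (reindex_inj rev_ord_inj) /=.
under eq_bigr => X _.
  have hX : (X <= N)%N by rewrite -ltnS.
  rewrite subSS tent_rev// -subzn//.
  have -> : t + - n.+1%:Z * (N%:Z - X%:Z) = t - n.+1%:Z * N%:Z + n.+1%:Z * X%:Z by ring.
  over.
by apply: pos => //; lia.
Qed.

(** The contribution of one pair of discs to the tent-weighted second moment. There a and b are
    twice the differences of the lattice coordinates of the discs, and t is the scaled difference of
    their values of th. *)
Definition tent_kernel (D W N : nat) (t a b : int) : int :=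
  \sum_(X < N.+1) \sum_(Y < N.+1)
     tent N X * tent N Y * autocorr D W (t + a * X%:Z + b * Y%:Z).

Lemma tent_kernelC D W N t a b : tent_kernel D W N t a b = tent_kernel D W N t b a.
Proof.
rewrite /tent_kernel exchange_big /=; apply: eq_bigr => X _; apply: eq_bigr => Y _.
by rewrite [tent N Y * _]mulrC addrAC.
Qed.

Lemma tent_kernel_trivial (D W N : nat) t a b : (0 < D)%N ->
  `|tent_kernel D W N t a b| <=
  N.+1%:Z ^+ 2 * (N%:Z ^+ 2 * ((D * W)%:Z * D%:Z ^+ 2)).
Proof.
move=> D0; rewrite expr2 -mulrA.
apply: (ler_norm_sum_const (F := fun X : nat => \sum_(Y < N.+1)
     tent N X * tent N Y * autocorr D W (t + a * X%:Z + b * Y%:Z))) => X hX.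
apply: (ler_norm_sum_const (F := fun Y : nat =>
     tent N X * tent N Y * autocorr D W (t + a * X%:Z + b * Y%:Z))) => Y hY.
have /andP[hX0 hXN] := @tent_bound N X hX.
have /andP[hY0 hYN] := @tent_bound N Y hY.
rewrite !normrM (ger0_norm hX0) (ger0_norm hY0).
apply: ler_pM; rewrite ?mulr_ge0//; first by rewrite expr2 ler_pM.
by rewrite [D%:Z ^+ 2]expr2 autocorr_bound.
Qed.

(** Cancellation is used in one variable only; the sum over the other is taken in absolute value. *)
Lemma tent_kernel_decay (D W N : nat) t a b : (0 < D)%N ->
  a != 0 -> `|a| <= (D * W)%:Z ->
  a ^+ 2 * `|tent_kernel D W N t a b| <=
  N.+1%:Z * (N%:Z * (5 * (D * W)%:Z *
    ((D * W)%:Z ^+ 2 * D%:Z + 3 * N%:Z * D%:Z ^+ 2 * a ^+ 2))).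
Proof.
move=> D0 a0 aV.
rewrite /tent_kernel exchange_big /= -[X in X * _ <= _]ger0_norm ?sqr_ge0// -normrM mulr_sumr.
apply: (ler_norm_sum_const (F := fun Y : nat => a ^+ 2 * \sum_(X < N.+1)
     tent N X * tent N Y * autocorr D W (t + a * X%:Z + b * Y%:Z))) => Y hY.
have /andP[hY0 hYN] := @tent_bound N Y hY.
have -> : a ^+ 2 * \sum_(X < N.+1) tent N X * tent N Y * autocorr D W (t + a * X%:Z + b * Y%:Z)
  = tent N Y * (a ^+ 2 * \sum_(X < N.+1) tent N X * autocorr D W ((t + b * Y%:Z) + a * X%:Z)).
  rewrite [RHS]mulrCA; congr (_ * _); rewrite mulr_sumr; apply: eq_bigr => X _.
  by rewrite [t + b * _ + _]addrAC; ring.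
rewrite normrM (ger0_norm hY0); apply: ler_pM => //.
by rewrite normrM [ `|a ^+ 2|]ger0_norm ?sqr_ge0// tent_autocorr_progression.
Qed.

Definition kernel_const (p q D : nat) : int :=
  (q%:Z + 1) ^+ 4 * (5 * p%:Z) *
  (p%:Z ^+ 2 * D%:Z + 12 * q%:Z * D%:Z ^+ 2 + D%:Z ^+ 2).

(** The square of the larger of |d1| and |d2| dominates their product, so cancellation in that
    direction alone suffices; the product form lets the kernel be summed as two harmonic series. The
    fine grid enters here: with D * W and N of order m^2 and |d| < m, the discretisation term N d^2
    is of order at most m^4, like the main term (D * W)^2, whereas a grid of mesh 1/m would make it
    too large. *)
Lemma tent_kernel_bound (D W N p q m : nat) t (d1 d2 : int) :
  (0 < D)%N -> (0 < m)%N -> (2 <= p)%N ->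
  (D * W = p * m ^ 2)%N -> (N = q * m ^ 2)%N ->
  `|d1| < m%:Z -> `|d2| < m%:Z ->
  Num.max 1 `|d1| * Num.max 1 `|d2| * `|tent_kernel D W N t (2 * d1) (2 * d2)|
   <= kernel_const p q D * m%:Z ^+ 10.
Proof.
move=> D0 m0 p2 hV hN h1 h2.
set K := `|tent_kernel _ _ _ _ _ _|.
pose M := m%:Z ^+ 2.
have M1 : 1 <= M by rewrite /M; nia.
have VE : (D * W)%:Z = p%:Z * M by rewrite hV PoszM /M -[Posz (m ^ 2)%N]natz natrX natz.
have NE : N%:Z = q%:Z * M by rewrite hN PoszM /M -[Posz (m ^ 2)%N]natz natrX natz.
have NS : N.+1%:Z <= (q%:Z + 1) * M by rewrite intS NE; nia.
have NS' : N%:Z <= (q%:Z + 1) * M by apply: le_trans NS; lia.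
have K0 : 0 <= K by [].
have normsq (x : int) : x ^+ 2 = `|x| * `|x| by rewrite -expr2 -normrX ger0_norm ?sqr_ge0.
have MM : M ^+ 5 = m%:Z ^+ 10 by rewrite /M -exprM.
have cst x : 0 <= x -> x <= (q%:Z + 1) ^+ 4 * x.
  by move=> x0; rewrite -[leLHS]mul1r ler_wpM2r// exprn_ege1//; lia.
have triv : K <= kernel_const p q D * m%:Z ^+ 10.
  apply: le_trans (@tent_kernel_trivial D W N t (2 * d1) (2 * d2) D0) _.
  apply: le_trans (_ : ((q%:Z + 1) * M) ^+ 2 * (((q%:Z + 1) * M) ^+ 2 * (p%:Z * M * D%:Z ^+ 2)) <= _).
    by rewrite VE !ler_pM// ?lerXn2r ?nnegrE// ?mulr_ge0// ?exprn_ge0//; lia.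
  rewrite -MM /kernel_const.
  rewrite -subr_ge0; set Z := (X in 0 <= X).
  have -> : Z = (q%:Z + 1) ^+ 4 * M ^+ 5 * p%:Z *
    (5 * (p%:Z ^+ 2 * D%:Z + 12 * q%:Z * D%:Z ^+ 2) + 4 * D%:Z ^+ 2) by rewrite /Z; ring.
  by rewrite !mulr_ge0// ?addr_ge0// ?mulr_ge0// ?exprn_ge0// addr_ge0.
have decay (a : int) b : `|a| < m%:Z -> a != 0 ->
    a ^+ 2 * `|tent_kernel D W N t (2 * a) b| <= kernel_const p q D * m%:Z ^+ 10.
  move=> am a0.
  have a2M : a ^+ 2 <= M by rewrite /M -(ger0_norm (sqr_ge0 a)) normrX lerXn2r ?nnegrE//; lia.
  have h := @tent_kernel_decay D W N t (2 * a) b D0.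
  have mM : m%:Z <= M by rewrite /M expr2 ler_peMr//; lia.
  have pM : 2 * M <= p%:Z * M by rewrite ler_wpM2r//; lia.
  have aM : `|2 * a| <= (D * W)%:Z.
    by rewrite VE (le_trans _ pM)// normrM ler_wpM2l// (le_trans (ltW am)).
  have {}h := h (mulf_neq0 (isT : 2 != 0 :> int) a0) aM.
  apply: le_trans (_ : (2 * a) ^+ 2 * `|tent_kernel D W N t (2 * a) b| <= _).
    by rewrite ler_wpM2r// exprMn ler_peMl// sqr_ge0.
  apply: le_trans h _.
  apply: le_trans (_ : ((q%:Z + 1) * M) * (((q%:Z + 1) * M) * (5 * (p%:Z * M) *
    ((p%:Z * M) ^+ 2 * D%:Z + 3 * (q%:Z * M) * D%:Z ^+ 2 * (4 * M)))) <= _).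
    have e : (2 * a) ^+ 2 <= 4 * M by rewrite exprMn; apply: ler_pM => //; exact: sqr_ge0.
    have e0 : 0 <= (2 * a) ^+ 2 by rewrite sqr_ge0.
    have M0 : 0 <= M by apply: le_trans M1.
    have pM0 : 0 <= p%:Z * M by rewrite mulr_ge0.
    have qM0 : 0 <= q%:Z * M by rewrite mulr_ge0.
    have i1 : 0 <= (p%:Z * M) ^+ 2 * D%:Z + 3 * (q%:Z * M) * D%:Z ^+ 2 * (2 * a) ^+ 2.
      by nonneg.
    rewrite VE NE in NS NS' *.
    apply: ler_pM => //; first by nonneg.
    apply: ler_pM => //; first by nonneg.
    apply: ler_wpM2l; first by nonneg.
    by rewrite lerD2l; apply: ler_wpM2l => //; nonneg.
  rewrite -MM /kernel_const.
  rewrite -subr_ge0; set Z := (X in 0 <= X).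
  have -> : Z = (q%:Z + 1) ^+ 2 * M ^+ 5 * (5 * p%:Z) *
    (((q%:Z + 1) ^+ 2 - 1) * (p%:Z ^+ 2 * D%:Z + 12 * q%:Z * D%:Z ^+ 2) + (q%:Z + 1) ^+ 2 * D%:Z ^+ 2).
    by rewrite /Z; ring.
  have q1 : 0 <= (q%:Z + 1) ^+ 2 - 1 by nia.
  have q2 : 0 <= q%:Z + 1 by lia.
  have M0 : 0 <= M by apply: le_trans M1.
  by clear -q1 q2 M0; nonneg.
have [e1|n1] := eqVneq d1 0; have [e2|n2] := eqVneq d2 0.
- by rewrite {1}e1 {1}e2 normr0 !max_l// mulr1 mul1r.
- rewrite {1}e1 normr0 max_l// mul1r.
  have e : 1 <= `|d2| by lia.
  rewrite max_r//; apply: le_trans (decay _ (2 * d1) h2 n2).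
  by rewrite -tent_kernelC -/K normsq ler_wpM2r// ler_peMr.
- rewrite {1}e2 normr0 (@max_l _ _ 1 0)// mulr1.
  have e : 1 <= `|d1| by lia.
  rewrite max_r//; apply: le_trans (decay _ (2 * d2) h1 n1).
  by rewrite -/K normsq ler_wpM2r// ler_peMr.
have e1 : 1 <= `|d1| by lia.
have e2 : 1 <= `|d2| by lia.
rewrite !max_r//.
have [h|h] : `|d1| <= `|d2| \/ `|d2| <= `|d1| by lia.
  apply: le_trans (decay _ (2 * d1) h2 n2).
  by rewrite -tent_kernelC -/K normsq ler_wpM2r// ler_wpM2r.
apply: le_trans (decay _ (2 * d2) h1 n1).
by rewrite -/K normsq ler_wpM2r// ler_wpM2l.
Qed.

(** * The high-low inequality on the integer lattice *)

Lemma sum_blocks (V : nmodType) (n m : nat) (f : nat -> V) :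
  \sum_(u < n) \sum_(e < m) f (m * u + e)%N = \sum_(X < n * m) f X.
Proof.
elim: n => [|n IH]; first by rewrite !big_ord0.
rewrite big_ord_recr /= IH -(big_mkord xpredT f).
have h : (n * m <= n.+1 * m)%N by rewrite leq_mul2r leqnSn orbT.
rewrite -(big_mkord (n := (n.+1 * m)%N) xpredT f) (big_cat_nat _ h)//.
congr (_ + _).
rewrite -{1}[(n * m)%N]add0n big_addn mulSn addnK big_mkord.
by apply: eq_bigr => e _; rewrite addnC mulnC.
Qed.

Lemma sqr_sum_le (K : realDomainType) (T : finType) (f : T -> K) :
  (\sum_x f x) ^+ 2 <= #|T|%:R * \sum_x f x ^+ 2.
Proof.
rewrite -subr_ge0 -(@pmulr_rge0 _ 2)//.
set S := \sum_x f x; set Q := \sum_x f x ^+ 2.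
have inner x : \sum_y (f x - f y) ^+ 2 = #|T|%:R * f x ^+ 2 - 2 * S * f x + Q.
  rewrite (eq_bigr (fun y => f x ^+ 2 + (- 2 * f x) * f y + f y ^+ 2)); last by move=> y _; ring.
  by rewrite !big_split /= sumr_const -mulr_sumr -/S -/Q -mulr_natl; ring.
suff -> : 2 * (#|T|%:R * Q - S ^+ 2) = \sum_x \sum_y (f x - f y) ^+ 2.
  by apply: sumr_ge0 => x _; apply: sumr_ge0 => y _; exact: sqr_ge0.
rewrite (eq_bigr _ (fun x _ => inner x)) big_split /= sumrB -!mulr_sumr sumr_const.
by rewrite -/S -/Q -mulr_natl; ring.
Qed.

Lemma sum_fiber_le (K : numDomainType) (I C : finType) (P : pred I) (c : I -> C)
    (g : C -> K) (b : nat) :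
  (forall x, (#|[set i | P i && (c i == x)]| <= b)%N) -> (forall x, 0 <= g x) ->
  \sum_(i | P i) g (c i) <= b%:R * \sum_x g x.
Proof.
move=> hb g0; rewrite (partition_big c xpredT)//= mulr_sumr.
apply: ler_sum => x _.
rewrite (eq_bigr (fun=> g x)); last by move=> i /andP[_ /eqP ->].
rewrite sumr_const -[leLHS]mulr_natl ler_wpM2r// ler_nat.
by apply: leq_trans (hb x); rewrite cardsE.
Qed.

(** The hypotheses place the support n - D * W < Z <= n of the second factor inside the range of Z;
    then z = n - Z. *)
Lemma window_corr (D W n Nz : nat) (s : int) : (0 < D)%N ->
  (D * W <= n)%N -> (n < Nz)%N ->
  \sum_(Z < Nz) window D W (s - Z%:Z) * window D W (n%:Z - Z%:Z) =
  autocorr D W (s - n%:Z).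
Proof.
move=> D0 hn nN; rewrite -(big_mkord xpredT
  (fun Z => window D W (s - Z%:Z) * window D W (n%:Z - Z%:Z))).
rewrite (big_cat_nat (n := n.+1))//= [X in _ + X]big_nat_cond.
rewrite [X in _ + X]big1 ?addr0; last first.
  move=> Z; rewrite andbT => hZ.
  by rewrite [window _ _ (n%:Z - _)]window_out ?mulr0//; lia.
rewrite big_nat_rev /= (big_cat_nat (n := (D * W)%N))//=; last by rewrite ltnW.
rewrite [X in _ + X]big_nat_cond [X in _ + X]big1 ?addr0; last first.
  move=> Z; rewrite andbT => hZ.
  rewrite [window _ _ (n%:Z - _)]window_out ?mulr0//.
  have e : D%:Z * W%:Z = (D * W)%N%:Z by rewrite PoszM.
  by rewrite e; lia.
rewrite big_mkord; apply: eq_bigr => z _.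
have hz : (z <= n)%N by have := ltn_ord z; lia.
by rewrite ?add0n ?subSS -subzn//; congr (window _ _ _ * window _ _ _); ring.
Qed.

Lemma sum_pair (V : nmodType) (T1 T2 : finType) (f : T1 * T2 -> V) :
  \sum_x f x = \sum_a \sum_b f (a, b).
Proof. by rewrite pair_bigA; apply: eq_bigr => -[]. Qed.

(* Grid model at scale 1/m: y = k/m, th = Th/m, x = u/m and z = w/m up to
   rounding, so that [defect] is m^2 (th - 2 x.y - z), while the second moment is
   taken over the finer grid (X, Y, Z) in m^-2 Z x m^-2 Z x m^-3 Z.  The keys are
   the unit squares to which incidences have been localised. *)
Section HighLow.
Variables (I J S : finType) (m D A nw : nat).
Variables (k1 k2 Th : J -> nat) (key' : J -> S).
Variables (u1 u2 : I -> 'I_(27 * m)) (w : I -> 'I_nw) (key : I -> S).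

Definition defect (i : I) (j : J) : int :=
  m%:Z * (Th j)%:Z - 2 * ((u1 i)%:Z * (k1 j)%:Z + (u2 i)%:Z * (k2 j)%:Z)
  - m%:Z * (w i)%:Z.

Definition near_count (B : nat) (i : I) : int :=
  \sum_(j | key' j == key i) (`|defect i j| <= B%:Z * m%:Z)%R%:R.

Definition width : nat := (2 * (A + 6) * m ^ 2)%N.

(** The shift by half of [width] centres the inner window at defect 0; the 6 in A + 6 leaves room
    for the offset, at most 5 m^2, of a grid point within its cell. *)
Definition level (j : J) (X Y : nat) : int :=
  m%:Z ^+ 2 * (Th j)%:Z - 2 * (X%:Z * (k1 j)%:Z + Y%:Z * (k2 j)%:Z)
  + (A%:Z + 6) * m%:Z ^+ 2.

Definition excess (Q : S) (X Y Z : nat) : int :=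
  \sum_(j | key' j == Q) window D width (level j X Y - Z%:Z).

Hypotheses (m0 : (0 < m)%N) (D0 : (0 < D)%N).
Hypotheses (k1m : forall j, (k1 j < m)%N) (k2m : forall j, (k2 j < m)%N).
Hypotheses (u1m : forall i, (9 * m <= u1 i < 18 * m)%N)
           (u2m : forall i, (9 * m <= u2 i < 18 * m)%N).
Hypothesis Thm : forall j,
  (108 * m + 2 * (A + 6) * D <= Th j)%N && (Th j + (A + 6) < nw)%N.

Lemma widthE : width%:Z = 2 * (A%:Z + 6) * m%:Z ^+ 2.
Proof. by rewrite /width !PoszM. Qed.

(** The window equals D - 1 on the close pairs, is at least -1 on the pairs of the wide range, and
    vanishes beyond. This holds at every grid point of the cell of the circle, which is what allows
    averaging over the cell later. *)
Lemma excess_ge (i : I) (e1 e2 f : nat) :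
  (e1 < m)%N -> (e2 < m)%N -> (f < m ^ 2)%N ->
  D%:Z * near_count A i - near_count (2 * (A + 6) * D + 5) i <=
  excess (key i) (m * u1 i + e1) (m * u2 i + e2) (m ^ 2 * w i + f).
Proof.
move=> he1 he2 hf; rewrite /near_count mulr_sumr -sumrB.
apply: ler_sum => j _.
pose z := 2 * (e1%:Z * (k1 j)%:Z + e2%:Z * (k2 j)%:Z) + f%:Z.
have le : level j (m * u1 i + e1) (m * u2 i + e2) - (m ^ 2 * w i + f)%N%:Z
    = m%:Z * defect i j - z + (A%:Z + 6) * m%:Z ^+ 2.
  by rewrite /level /defect /z !PoszD !PoszM; ring.
have hk1 := k1m j; have hk2 := k2m j.
have z0 : 0 <= z by rewrite /z addr_ge0// mulr_ge0// addr_ge0.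
(* 5 = 2 + 2 + 1, from the offsets e1, e2 and f. *)
have z1 : z <= 5 * m%:Z ^+ 2.
  have a1 : e1%:Z * (k1 j)%:Z <= m%:Z ^+ 2 by rewrite expr2 ler_pM//; lia.
  have a2 : e2%:Z * (k2 j)%:Z <= m%:Z ^+ 2 by rewrite expr2 ler_pM//; lia.
  have a3 : f%:Z <= m%:Z ^+ 2 by move: hf; rewrite -mulnn; lia.
  by rewrite /z; move: a1 a2 a3; lia.
have VE : D%:Z * width%:Z = 2 * (A%:Z + 6) * D%:Z * m%:Z ^+ 2 by rewrite widthE; ring.
rewrite le /window VE widthE {le VE}.
have mm : 1 <= m%:Z by lia.
have M1 : 1 <= m%:Z ^+ 2 by rewrite exprn_ege1.
have DD : 1 <= D%:Z by lia.
have -> : (2 * (A + 6) * D + 5)%N%:Z = 2 * (A%:Z + 6) * D%:Z + 5 by [].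
set p := 2 * (A%:Z + 6) * D%:Z.
have p1 : 2 * (A%:Z + 6) <= p by rewrite /p ler_peMr.
have p2 : 2 * (A%:Z + 6) * m%:Z ^+ 2 <= p * m%:Z ^+ 2 by rewrite ler_wpM2r// sqr_ge0.
set d := defect i j; set M := m%:Z ^+ 2 in z1 M1 p2 *.
have near : `|d| <= A%:Z * m%:Z -> `|m%:Z * d| <= A%:Z * M.
  by move=> h; rewrite normrM /M expr2 mulrCA ler_wpM2l.
have pm : A%:Z * m%:Z <= (p + 5) * m%:Z by rewrite ler_wpM2r//; lia.
have AM0 : 0 <= A%:Z * M by rewrite mulr_ge0// sqr_ge0.
have e6 : (A%:Z + 6) * M = A%:Z * M + 6 * M by ring.
have e62 : 2 * (A%:Z + 6) * M = 2 * (A%:Z * M) + 12 * M by ring.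
have far : ~~ (`|d| <= (p + 5) * m%:Z) -> `|m%:Z * d| > p * M + 5 * M.
  rewrite -ltNge => h; rewrite normrM ger0_norm//.
  have -> : p * M + 5 * M = m%:Z * ((p + 5) * m%:Z) by rewrite /M; ring.
  by rewrite ltr_pM2l.
rewrite e6 e62 in p2 *.
move: (p * M) (A%:Z * M) (m%:Z * d) p2 near AM0 far => pM AM md p2 near AM0 far.
have [dA|dA] := boolP (`|d| <= A%:Z * m%:Z).
  have hn := near dA.
  have -> : `|d| <= (p + 5) * m%:Z by apply: le_trans pm.
  do 2?(case: ifP => ?); lia.
case: (boolP (`|d| <= _)) => hd; last have hf' := far hd; do 2?(case: ifP => ?); lia.
Qed.

Lemma sum_excess_sqr :
  \sum_Q \sum_(X < 27 * m ^ 2) \sum_(Y < 27 * m ^ 2) \sum_(Z < m ^ 2 * nw)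
     tent (27 * m ^ 2) X * tent (27 * m ^ 2) Y * excess Q X Y Z ^+ 2 =
  \sum_j \sum_(j' | key' j' == key' j)
     tent_kernel D width (27 * m ^ 2) (m%:Z ^+ 2 * ((Th j)%:Z - (Th j')%:Z))
       (2 * ((k1 j')%:Z - (k1 j)%:Z)) (2 * ((k2 j')%:Z - (k2 j)%:Z)).
Proof.
set N := (27 * m ^ 2)%N.
have tN : tent N N = 0 by rewrite /tent; lia.
(* The support of every window must fit in the range of Z. The 108 m in the hypothesis on [Th]
   covers the linear term, which is at most 4 N m = 108 m^3. *)
have lev j X Y : (X < N)%N -> (Y < N)%N ->
    (D * width)%:Z <= level j X Y < (m ^ 2 * nw)%:Z.
  move=> hX hY; have /andP[T1 T2] := Thm j; have h1 := k1m j; have h2 := k2m j.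
  have b1 : X%:Z * (k1 j)%:Z <= N%:Z * m%:Z by rewrite ler_pM//; lia.
  have b2 : Y%:Z * (k2 j)%:Z <= N%:Z * m%:Z by rewrite ler_pM//; lia.
  have b3 : 0 <= X%:Z * (k1 j)%:Z by rewrite mulr_ge0.
  have b4 : 0 <= Y%:Z * (k2 j)%:Z by rewrite mulr_ge0.
  have M0 : 0 < m%:Z ^+ 2 by rewrite exprn_gt0.
  have T1' : m%:Z ^+ 2 * (108 * m%:Z + 2 * (A%:Z + 6) * D%:Z) <= m%:Z ^+ 2 * (Th j)%:Z.
    by rewrite ler_pM2l//; move: T1; clear; lia.
  have T2' : m%:Z ^+ 2 * ((Th j)%:Z + A%:Z + 6) < m%:Z ^+ 2 * nw%:Z.
    by rewrite ltr_pM2l//; move: T2; clear; lia.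
  have NE : N%:Z * m%:Z = 27 * m%:Z ^+ 2 * m%:Z by rewrite /N PoszM.
  have e1 : m%:Z ^+ 2 * (108 * m%:Z + 2 * (A%:Z + 6) * D%:Z) =
     4 * (N%:Z * m%:Z) + D%:Z * width%:Z by rewrite NE widthE; ring.
  have e2 : m%:Z ^+ 2 * ((Th j)%:Z + A%:Z + 6) = m%:Z ^+ 2 * (Th j)%:Z + (A%:Z + 6) * m%:Z ^+ 2 by ring.
  have p6 : 0 <= (A%:Z + 6) * m%:Z ^+ 2 by rewrite mulr_ge0// ltW.
  have eM : (m ^ 2 * nw)%N%:Z = m%:Z ^+ 2 * nw%:Z by rewrite !PoszM.
  have eD : (D * width)%N%:Z = D%:Z * width%:Z by rewrite PoszM.
  rewrite /level eM eD.
  rewrite e1 in T1'; rewrite e2 in T2'.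
  by apply/andP; split; lia.
have corr j j' X Y : (X < N)%N -> (Y < N)%N ->
   \sum_(Z < m ^ 2 * nw) window D width (level j X Y - Z%:Z) * window D width (level j' X Y - Z%:Z)
   = autocorr D width (level j X Y - level j' X Y).
  move=> hX hY; have /andP[] := lev j' X Y hX hY.
  by case: (level j' X Y) => // n h1 h2; apply: window_corr.
pose F X Y j j' := tent N X * tent N Y * autocorr D width (level j X Y - level j' X Y).
transitivity (\sum_(X < N) \sum_(Y < N) \sum_j \sum_(j' | key' j' == key' j) F X Y j j').
  rewrite exchange_big; apply: eq_bigr => X _; rewrite exchange_big; apply: eq_bigr => Y _.
  rewrite [RHS](partition_big key' xpredT)//=; apply: eq_bigr => Q _.
  under eq_bigr => Z _ do rewrite expr2 /excess big_distrlr /= mulr_sumr.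
  rewrite exchange_big /=; apply: eq_bigr => j /eqP jQ.
  under eq_bigr => Z _ do rewrite mulr_sumr.
  rewrite exchange_big /= jQ; apply: eq_bigr => j' _.
  by rewrite -mulr_sumr corr.
under eq_bigr => X _ do rewrite exchange_big.
rewrite exchange_big; apply: eq_bigr => j _ /=.
under eq_bigr => X _ do rewrite exchange_big.
rewrite exchange_big; apply: eq_bigr => j' _ /=.
(* [tent_kernel] runs up to X = Y = N, one more than the grid, but the tent is zero there. *)
rewrite /tent_kernel big_ord_recr /= [X in _ = _ + X]big1 ?addr0; last first.
  by move=> Y _; rewrite tN !mul0r.
apply: eq_bigr => X _; rewrite big_ord_recr /= tN mulr0 mul0r addr0.
apply: eq_bigr => Y _; rewrite /F; congr (_ * autocorr _ _ _).
by rewrite /level; ring.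
Qed.

(** The lower bound on the excess is summed over the m^4 grid points of each cell and squared by
    Cauchy-Schwarz. At most b circles share a key and a cell, so the sum over circles is at most b
    times a sum over the whole grid; there the tents, each at least m^2 on the cells used, may be
    inserted. *)
Lemma high_low_sqr (b : nat) :
  (forall c, (#|[set i | (key i, (u1 i, (u2 i, w i))) == c]| <= b)%N) ->
  let X := D%:Z * (\sum_i near_count A i) -
     \sum_i near_count (2 * (A + 6) * D + 5) i in
  0 <= X ->
  X ^+ 2 * m%:Z ^+ 8 <= #|I|%:Z * (b%:Z * \sum_j \sum_(j' | key' j' == key' j)
     `|tent_kernel D width (27 * m ^ 2) (m%:Z ^+ 2 * ((Th j)%:Z - (Th j')%:Z))
       (2 * ((k1 j')%:Z - (k1 j)%:Z)) (2 * ((k2 j')%:Z - (k2 j)%:Z))|).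
Proof.
move=> hb X X0.
set M := (m ^ 2)%N; set N := (27 * M)%N.
have ME : M%:Z = m%:Z ^+ 2 by rewrite /M PoszM.
have m1 : 0 < m%:Z by lia.
pose f (x : I * ('I_m * ('I_m * 'I_M))) : int :=
  excess (key x.1) (m * u1 x.1 + x.2.1) (m * u2 x.1 + x.2.2.1) (M * w x.1 + x.2.2.2).
have T1 : m%:Z ^+ 4 * X <= \sum_x f x.
  rewrite /X mulr_sumr -sumrB mulr_sumr sum_pair; apply: ler_sum => i _.
  have -> : m%:Z ^+ 4 = #|{: 'I_m * ('I_m * 'I_M)}|%:Z.
    by rewrite !card_prod !card_ord !PoszM; ring.
  rewrite -natz mulr_natl -sumr_const; apply: ler_sum => -[e1 [e2 e]] _.
  by apply: excess_ge.
have T2 := sqr_sum_le f.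
have T3 : M%:Z ^+ 2 * \sum_x f x ^+ 2 <=
   b%:R * \sum_Q \sum_(X < N) \sum_(Y < N) \sum_(Z < M * nw)
     tent N X * tent N Y * excess Q X Y Z ^+ 2.
  pose h Q X Y Z := tent N X * tent N Y * excess Q X Y Z ^+ 2.
  have tent0 : forall x, (x < N)%N -> 0 <= tent N x.
    by move=> x hx; case/andP: (@tent_bound N x (ltnW hx)).
  pose g (c : S * ('I_(27 * m) * ('I_(27 * m) * 'I_nw))) : int :=
    \sum_(e1 < m) \sum_(e2 < m) \sum_(e < M)
      h c.1 (m * c.2.1 + e1)%N (m * c.2.2.1 + e2)%N (M * c.2.2.2 + e)%N.
  have ltN (u : 'I_(27 * m)) (e : 'I_m) : (m * u + e < N)%N.
    have := ltn_ord u; have := ltn_ord e; rewrite /N /M -mulnn; clear; nia.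
  have -> : \sum_Q \sum_(X < N) \sum_(Y < N) \sum_(Z < M * nw) h Q X Y Z = \sum_c g c.
    rewrite sum_pair; apply: eq_bigr => Q _; rewrite sum_pair.
    have -> : N = (27 * m * m)%N by rewrite /N /M -mulnn mulnA.
    rewrite -(sum_blocks _ _ (fun X => \sum_(Y < 27 * m * m) \sum_(Z < M * nw) h Q X Y Z)).
    apply: eq_bigr => U _; rewrite sum_pair.
    rewrite /g /=.
    under [RHS]eq_bigr => U' _ do rewrite exchange_big /=.
    rewrite [RHS]exchange_big /=; apply: eq_bigr => e1 _.
    rewrite -(sum_blocks _ _ (fun Y => \sum_(Z < M * nw) h Q (m * U + e1)%N Y Z)).
    apply: eq_bigr => U' _.
    rewrite [RHS]exchange_big /=; apply: eq_bigr => e2 _.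
    by rewrite mulnC -(sum_blocks _ _ (fun Z => h Q (m * U + e1)%N (m * U' + e2)%N Z)).
  apply: le_trans (sum_fiber_le (P := xpredT) hb _); last first.
    move=> c; rewrite /g; do 3!(apply: sumr_ge0 => ? _).
    by rewrite /h mulr_ge0 ?sqr_ge0// mulr_ge0// tent0 ?ltN.
  rewrite sum_pair mulr_sumr; apply: ler_sum => i _.
  rewrite /g sum_pair mulr_sumr; apply: ler_sum => e1 _.
  rewrite sum_pair mulr_sumr; apply: ler_sum => e2 _.
  rewrite mulr_sumr; apply: ler_sum => e _.
  rewrite /h /f /= ler_wpM2r ?sqr_ge0// expr2.
  have big (u : 'I_(27 * m)) (x : 'I_m) : (9 * m <= u < 18 * m)%N -> M%:Z <= tent N (m * u + x).
    have := ltn_ord x; rewrite /tent /N /M -mulnn; clear; nia.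
  by rewrite ler_pM ?big.
rewrite sum_excess_sqr -/N in T3.
set K := \sum_j \sum_(j' | _) `|_|.
set K' := \sum_j \sum_(j' | _) _ in T3.
have KK : K' <= K.
  by apply: ler_sum => j _; apply: ler_sum => j' _; exact: ler_norm.
have T4 : (m%:Z ^+ 4 * X) ^+ 2 <= (\sum_x f x) ^+ 2.
  have p0 : 0 <= m%:Z ^+ 4 * X by rewrite mulr_ge0// exprn_ge0.
  by rewrite lerXn2r ?nnegrE// (le_trans p0).
have M4 : 0 < m%:Z ^+ 4 by rewrite exprn_gt0.
rewrite -(ler_pM2l M4) -(ler_pM2l M4).
have -> : m%:Z ^+ 4 * (m%:Z ^+ 4 * (X ^+ 2 * m%:Z ^+ 8)) = m%:Z ^+ 8 * (m%:Z ^+ 4 * X) ^+ 2 by ring.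
apply: le_trans (ler_wpM2l (exprn_ge0 8 (ltW m1)) (le_trans T4 T2)) _.
have -> : #|{: I * ('I_m * ('I_m * 'I_M))}|%:R = #|I|%:Z * m%:Z ^+ 4.
  by rewrite !card_prod !card_ord natz !PoszM; ring.
have -> : m%:Z ^+ 8 * (#|I|%:Z * m%:Z ^+ 4 * (\sum_x f x ^+ 2)) =
  m%:Z ^+ 4 * (m%:Z ^+ 4 * (#|I|%:Z * (M%:Z ^+ 2 * \sum_x f x ^+ 2))) by rewrite ME; ring.
rewrite (ler_pM2l M4) (ler_pM2l M4); apply: ler_wpM2l => //; apply: le_trans T3 _.
by rewrite natz ler_wpM2l.
Qed.
End HighLow.

(** * Summing the kernel *)

Definition harmonic (R : realType) (m : nat) : R :=
  \sum_(i < m) ((maxn 1 i)%:R)^-1.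

Lemma harmonic_le (R : realType) (m : nat) :
  (0 < m)%N -> harmonic R m <= 2 + ln m%:R.
Proof.
case: m => // m _; case: m => [|m].
  by rewrite /harmonic big_ord1 /= invr1 ln1 addr0 ler1n.
(* The sharper bound carries the induction: passing from m + 1 to m + 2 inside the logarithm gains
   at least 1 / (m + 2), because ln (1 - x) <= - x. *)
have : harmonic R m.+2 <= 2 + ln m.+1%:R.
  elim: m => [|m IH].
    by rewrite /harmonic !big_ord_recr big_ord0 /= !maxnE /= invr1 ln1 addr0 add0r.
  rewrite /harmonic big_ord_recr /= -/(harmonic R m.+2).
  apply: le_trans (lerD IH (lexx _)) _.
  rewrite -addrA lerD2l /maxn /=.
  have p : 0 < (m.+2%:R : R) by rewrite ltr0n.
  have e : (m.+1%:R : R) = m.+2%:R * (1 - m.+2%:R^-1).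
    by rewrite mulrBr mulr1 divff ?gt_eqF// -[m.+2%:R]natr1 addrK.
  have q : 0 < 1 - (m.+2%:R : R)^-1.
    by rewrite subr_gt0 invf_lt1// ltr1n.
  rewrite e lnM ?posrE// -addrA gerDl.
  have := @le_ln1Dx R (- m.+2%:R^-1).
  rewrite ltrNr opprK invf_lt1// ltr1n => /(_ isT).
  by rewrite -lerBrDr sub0r.
move/le_trans; apply; rewrite lerD2l ler_ln ?posrE ?ltr0n// ler_nat//.
Qed.

Lemma sum_inv_dist_le (R : realType) (m k0 : nat) : (k0 < m)%N ->
  \sum_(k < m) ((Num.max 1 `|k%:Z - k0%:Z|)%:~R)^-1 <= 2 * harmonic R m.
Proof.
move=> k0m; rewrite -(big_mkord xpredT (fun k => ((Num.max 1 `|k%:Z - k0%:Z|)%:~R : R)^-1)).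
rewrite (big_cat_nat (n := k0)) //=; last exact: ltnW.
have H0 n : (n <= m)%N -> \sum_(i < n) ((maxn 1 i)%:R : R)^-1 <= harmonic R m.
  move=> nm; rewrite /harmonic -(big_mkord xpredT (fun i => ((maxn 1 i)%:R : R)^-1)).
  rewrite -(big_mkord (n := m) xpredT (fun i => ((maxn 1 i)%:R : R)^-1)) (big_cat_nat (n := n) (p := m))//=.
  by rewrite lerDl sumr_ge0.
have conv (z : int) (n : nat) : `|z| = n%:Z -> ((Num.max 1 `|z|)%:~R : R) = (maxn 1 n)%:R.
  by move=> ->; have -> : Num.max 1 n%:Z = (maxn 1 n)%:Z by lia.
rewrite mulrDl mul1r lerD//.
  rewrite big_nat_rev /= big_mkord add0n.
  rewrite (eq_bigr (fun i : 'I_k0 => ((maxn 1 i.+1)%:R : R)^-1)); last first.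
    by move=> i _; congr (_^-1); apply: conv; have := ltn_ord i; lia.
  apply: le_trans (H0 k0.+1 _) => //.
  by rewrite big_ord_recl /= lerDr.
rewrite -{1}[k0]add0n big_addn big_mkord.
apply: le_trans (H0 (m - k0)%N _); last exact: leq_subr.
apply: ler_sum => i _; rewrite (conv _ i)//; lia.
Qed.

(** Grouped by lattice cell, with at most a discs of one key in each, the product bound on the
    kernel factors into two harmonic sums. *)
Lemma kernel_row_sum (R : realType) (J S : finType) (m D A a : nat)
    (k1 k2 Th : J -> nat) (key' : J -> S) (j : J) :
  (0 < m)%N -> (0 < D)%N ->
  (forall j, (k1 j < m)%N) -> (forall j, (k2 j < m)%N) ->
  (forall Q c1 c2, (#|[set j' | (key' j' == Q) && ((k1 j' == c1) && (k2 j' == c2))]| <= a)%N) ->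
  \sum_(j' | key' j' == key' j)
     `|tent_kernel D (width m A) (27 * m ^ 2) (m%:Z ^+ 2 * ((Th j)%:Z - (Th j')%:Z))
       (2 * ((k1 j')%:Z - (k1 j)%:Z)) (2 * ((k2 j')%:Z - (k2 j)%:Z))|%:~R
  <= a%:R * ((kernel_const (2 * (A + 6) * D) 27 D)%:~R * m%:R ^+ 10 *
       (2 * harmonic R m) ^+ 2).
Proof.
move=> m0 D0 k1m k2m ha.
set C : R := (kernel_const _ _ _)%:~R.
pose g1 (k : nat) : R := ((Num.max 1 `|k%:Z - (k1 j)%:Z|)%:~R)^-1.
pose g2 (k : nat) : R := ((Num.max 1 `|k%:Z - (k2 j)%:Z|)%:~R)^-1.
have max0 (z : int) : 0 < ((Num.max 1 `|z|)%:~R : R) by rewrite ltr0z; lia.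
have g10 k : 0 <= g1 k by rewrite invr_ge0 ltW.
have g20 k : 0 <= g2 k by rewrite invr_ge0 ltW.
have C0 : 0 <= C by rewrite ler0z /kernel_const; clear; nonneg.
pose c j' : 'I_m * 'I_m := (Ordinal (k1m j'), Ordinal (k2m j')).
pose g (x : 'I_m * 'I_m) : R := C * m%:R ^+ 10 * (g1 x.1 * g2 x.2).
have g0 x : 0 <= g x by rewrite /g !mulr_ge0// exprn_ge0.
apply: (@le_trans _ _ (\sum_(j' | key' j' == key' j) g (c j'))).
  apply: ler_sum => j' _; rewrite /g /c /=.
  rewrite mulrA ler_pdivlMr// ler_pdivlMr// -!intrM -natrX -[(m ^ 10)%:R]/((m ^ 10)%:Z%:~R) -intrM ler_int.
  have -> : (m ^ 10)%N%:Z = m%:Z ^+ 10 by rewrite -[LHS]natz natrX natz.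
  rewrite -[leLHS]mulrA [leLHS]mulrC [Num.max _ _ * Num.max _ _]mulrC.
  have p2 : (2 <= 2 * (A + 6) * D)%N by rewrite -mulnA leq_pmulr// muln_gt0 D0 addn_gt0 orbT.
  have hV : (D * width m A = 2 * (A + 6) * D * m ^ 2)%N.
    by rewrite /width mulnA [(D * _)%N]mulnC.
  have d1 : `|(k1 j')%:Z - (k1 j)%:Z| < m%:Z by move: (k1m j') (k1m j); clear; lia.
  have d2 : `|(k2 j')%:Z - (k2 j)%:Z| < m%:Z by move: (k2m j') (k2m j); clear; lia.
  exact: (tent_kernel_bound (q := 27) _ D0 m0 p2 hV erefl d1 d2).
apply: le_trans (@sum_fiber_le _ _ _ (fun j' => key' j' == key' j) c g a _ g0) _.
  move=> x; apply: leq_trans (ha (key' j) x.1 x.2); apply: subset_leq_card.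
  by apply/fintype.subsetP => j'; rewrite !inE => /andP[-> /eqP <-] /=; rewrite !eqxx.
have -> : \sum_x g x = C * m%:R ^+ 10 * ((\sum_(k < m) g1 k) * (\sum_(k < m) g2 k)).
  rewrite big_distrlr /= mulr_sumr sum_pair; apply: eq_bigr => x _.
  by rewrite mulr_sumr.
apply: ler_wpM2l => //; apply: ler_wpM2l; first by rewrite mulr_ge0// exprn_ge0.
by rewrite expr2; apply: ler_pM; rewrite ?sumr_ge0// /g1 /g2; exact: sum_inv_dist_le.
Qed.

(** The square root of the second-moment bound: m^10 from the kernel against m^8 on the left leaves
    a single factor m, and the two harmonic sums leave one. *)
Lemma high_low_discrete (R : realType) (I J S : finType) (m D A nw a b : nat)
    (k1 k2 Th : J -> nat) (key' : J -> S)
    (u1 u2 : I -> 'I_(27 * m)) (w : I -> 'I_nw) (key : I -> S) :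
  (0 < m)%N -> (0 < D)%N ->
  (forall j, (k1 j < m)%N) -> (forall j, (k2 j < m)%N) ->
  (forall i, (9 * m <= u1 i < 18 * m)%N) ->
  (forall i, (9 * m <= u2 i < 18 * m)%N) ->
  (forall j, (108 * m + 2 * (A + 6) * D <= Th j)%N && (Th j + (A + 6) < nw)%N) ->
  (forall Q c1 c2, (#|[set j' | (key' j' == Q) && ((k1 j' == c1) && (k2 j' == c2))]| <= a)%N) ->
  (forall c, (#|[set i | (key i, (u1 i, (u2 i, w i))) == c]| <= b)%N) ->
  D%:R * (\sum_i near_count k1 k2 Th key' u1 u2 w key A i)%:~R <=
  (\sum_i near_count k1 k2 Th key' u1 u2 w key (2 * (A + 6) * D + 5) i)%:~R +
  m%:R * (2 * harmonic R m) *
    Num.sqrt ((kernel_const (2 * (A + 6) * D) 27 D)%:~R * (a%:R * b%:R * (#|I|%:R * #|J|%:R))) :> R.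
Proof.
move=> m0 D0 k1m k2m u1m u2m Thm ha hb.
set C : R := (kernel_const _ _ _)%:~R.
have C0 : 0 <= C by rewrite ler0z /kernel_const; clear; nonneg.
have H0 : 0 <= harmonic R m by apply: sumr_ge0 => i _; rewrite invr_ge0.
set s1 := \sum_i _; set s2 := \sum_i _.
rewrite -lerBlDl -[D%:R]/(D%:Z%:~R) -intrM -intrB.
have [X0|X0] := leP (D%:Z * s1 - s2) 0.
  apply: (@le_trans _ _ 0); first by rewrite lerz0.
  by rewrite !mulr_ge0// sqrtr_ge0.
have := @high_low_sqr I J S m D A nw k1 k2 Th key' u1 u2 w key m0 D0 k1m k2m u1m u2m Thm b hb (ltW X0).
rewrite -/s1 -/s2; set X := D%:Z * s1 - s2 in X0 *.
set K := \sum_j \sum_(j' | _) _ => h.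
have hK : K%:~R <= #|J|%:R * (a%:R * (C * m%:R ^+ 10 * (2 * harmonic R m) ^+ 2)).
  rewrite /K rmorph_sum /= mulr_natl -sumr_const; apply: ler_sum => j _.
  by rewrite rmorph_sum /=; apply: kernel_row_sum.
have X0' : 0 < (X%:~R : R) by rewrite ltr0z.
have m0' : 0 < (m%:R : R) by rewrite ltr0n.
rewrite -(@ler_pXn2r _ 2)// ?nnegrE ?mulr_ge0// ?sqrtr_ge0// ?(ltW X0')//.
rewrite exprMn sqr_sqrtr ?mulr_ge0//.
rewrite -(ler_pM2r (exprn_gt0 8 m0')).
have h' : (X%:~R : R) ^+ 2 * m%:R ^+ 8 <= #|I|%:R * (b%:R * K%:~R).
  have e1 : (X ^+ 2 * m%:Z ^+ 8)%:~R = (X%:~R : R) ^+ 2 * m%:R ^+ 8 by rewrite intrM !rmorphXn.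
  by move: h; rewrite -(ler_int R) e1 [(_ * (_ * K))%:~R]intrM [(_ * K)%:~R]intrM.
apply: le_trans h' _.
apply: le_trans (_ : #|I|%:R * (b%:R * (#|J|%:R * (a%:R * (C * m%:R ^+ 10 * (2 * harmonic R m) ^+ 2)))) <= _).
  by do 2!apply: ler_wpM2l => //.
by rewrite le_eqVlt; apply/orP; left; apply/eqP; ring.
Qed.

(** * One step of scale for real parameters *)

(** 77 = 2 * (19 + 19) + 1: rounding down both factors of a product x y costs at most 18 M + M, and
    the two linear terms have opposite signs and cost at most M together. *)
Lemma rounding_error (R : realFieldType) (M x1 x2 y1 y2 th z L u1 u2 k1 k2 T w : R) :
  1 <= M -> 0 <= x1 -> x1 <= 18 -> 0 <= x2 -> x2 <= 18 ->
  0 <= k1 -> 0 <= k2 -> y1 <= 1 -> y2 <= 1 ->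
  u1 <= M * x1 -> M * x1 < u1 + 1 -> u2 <= M * x2 -> M * x2 < u2 + 1 ->
  k1 <= M * y1 -> M * y1 < k1 + 1 -> k2 <= M * y2 -> M * y2 < k2 + 1 ->
  T <= M * (th + L) -> M * (th + L) < T + 1 ->
  w <= M * (z + L) -> M * (z + L) < w + 1 ->
  `|M ^+ 2 * (th - 2 * (x1 * y1 + x2 * y2) - z)
    - (M * T - 2 * (u1 * k1 + u2 * k2) - M * w)| <= 77 * M.
Proof.
move=> M1 x10 x18 x20 x28 k10 k20 y1l y2l.
have M0 : 0 <= M by apply: le_trans M1.
have MX (x : R) : x <= 18 -> M * x <= 18 * M by move=> h; rewrite mulrC ler_wpM2r.
have MY (y : R) : y <= 1 -> M * y <= M by move=> h; rewrite ler_piMr.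
have := MX _ x18; have := MX _ x28; have := MY _ y1l; have := MY _ y2l.
have X10 : 0 <= M * x1 by rewrite mulr_ge0.
have X20 : 0 <= M * x2 by rewrite mulr_ge0.
have -> : M ^+ 2 * (th - 2 * (x1 * y1 + x2 * y2) - z) =
  M * (M * (th + L)) - 2 * ((M * x1) * (M * y1) + (M * x2) * (M * y2)) - M * (M * (z + L)) by ring.
have prod (X Y u k : R) : 0 <= X -> X <= 18 * M -> 0 <= k -> Y <= M ->
   u <= X -> X < u + 1 -> k <= Y -> Y < k + 1 -> 0 <= X * Y - u * k <= 19 * M.
  move=> h1 h2 h3 h4 h5 h6 h7 h8.
  have -> : X * Y - u * k = X * (Y - k) + (X - u) * k by ring.
  have a1 : 0 <= X * (Y - k) by rewrite mulr_ge0// subr_ge0.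
  have a2 : 0 <= (X - u) * k by rewrite mulr_ge0// subr_ge0.
  have a3 : X * (Y - k) <= 18 * M by apply: le_trans h2; rewrite ler_piMr//; lra.
  have a4 : (X - u) * k <= M by apply: (@le_trans _ _ k); [rewrite ler_piMl//; lra | lra].
  by apply/andP; split; lra.
have lin (X u : R) : u <= X -> X < u + 1 -> 0 <= M * X - M * u <= M.
  move=> h1 h2; rewrite -mulrBr mulr_ge0 ?subr_ge0//= ler_piMr//; lra.
move: X10 X20; move: (M * x1) (M * x2) (M * y1) (M * y2) (M * (th + L)) (M * (z + L)).
move=> X1 X2 Y1 Y2 T' w' X10 X20 Y2M Y1M X2M X1M h1 h1' h2 h2' h3 h3' h4 h4' h5 h5' h6 h6'.
have /andP[p1 p1'] := prod X1 Y1 u1 k1 X10 X1M k10 Y1M h1 h1' h3 h3'.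
have /andP[p2 p2'] := prod X2 Y2 u2 k2 X20 X2M k20 Y2M h2 h2' h4 h4'.
have /andP[p3 p3'] := lin T' T h5 h5'.
have /andP[p4 p4'] := lin w' w h6 h6'.
by rewrite ler_norml; apply/andP; split; lra.
Qed.

Definition cone_defect (R : realType) (I J : Type) (x1 x2 z : I -> R)
    (y1 y2 th : J -> R) (i : I) (j : J) : R :=
  th j - 2 * (x1 i * y1 j + x2 i * y2 j) - z i.

Definition pair_count (R : realType) (I J S : finType) (key : I -> S) (key' : J -> S)
    (t : I -> J -> R) (rho : R) : R :=
  \sum_i \sum_(j | key' j == key i) (`|t i j| <= rho)%R%:R.

(** 84 is the value of A at which the lattice inequality is applied; the 4 collects m <= 2 / rho and
    the factor 2 of the two-sided harmonic sums. *)
Definition step_const (R : realType) (D : nat) : R :=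
  4 * Num.sqrt (kernel_const (2 * (84 + 6) * D) 27 D)%:~R.

(** Rounding to a lattice of mesh 1 / m with 1 / rho < m <= 2 / rho. A pair with |t| <= rho has
    defect at most 2 m + 77 m <= 84 m; conversely a defect of at most (180 D + 5) m gives |t| <=
    (180 D + 82) / m <= 300 D rho, which is the origin of 300. *)
Lemma high_low_step (R : realType) (I J S : finType) (x1 x2 z : I -> R)
    (y1 y2 th : J -> R) (key : I -> S) (key' : J -> S) (D : nat) (rho a b : R) :
  (0 < D)%N -> 0 < rho -> rho <= 1 ->
  (forall i, 9 <= x1 i < 18) -> (forall i, 9 <= x2 i < 18) -> (forall i, -50 <= z i <= 50) ->
  (forall j, 0 <= y1 j < 1) -> (forall j, 0 <= y2 j < 1) -> (forall j, 0 <= th j <= 100) ->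
  0 <= a -> 0 <= b ->
  (forall Q c1 c2, #|[set j | [&& key' j == Q, `|y1 j - c1| <= rho & `|y2 j - c2| <= rho]]|%:R <= a) ->
  (forall Q c1 c2 c3, #|[set i | [&& key i == Q, `|x1 i - c1| <= rho, `|x2 i - c2| <= rho
      & `|z i - c3| <= rho]]|%:R <= b) ->
  D%:R * pair_count key key' (cone_defect x1 x2 z y1 y2 th) rho <=
    pair_count key key' (cone_defect x1 x2 z y1 y2 th) (300 * D%:R * rho) +
    step_const R D * rho^-1 * (3 - ln rho) * Num.sqrt (a * b * (#|I|%:R * #|J|%:R)).
Proof.
move=> D0 r0 r1 hx1 hx2 hz hy1 hy2 hth a0 b0 ha hb.
set t := cone_defect _ _ _ _ _ _.
have ri1 : 1 <= rho^-1 by rewrite invf_ge1.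
have [m [m_le m_gt m0]] : exists m : nat, [/\ m%:R <= 2 * rho^-1, rho^-1 < m%:R & (0 < m)%N].
  exists (Num.truncn rho^-1).+1.
  have /andP[h1 h2] := truncn_itv (ltW (lt_le_trans ltr01 ri1)).
  by split => //; rewrite -natr1; lra.
(* Translating th and z by the same L preserves th - z. It makes both nonnegative before truncation
   and supplies the lower bound (108 + 180 D) m required of [Th]. *)
have [L LE] : exists L : nat, (L%:R : R) = 300 + 180 * D%:R.
  by exists (300 + 180 * D)%N; rewrite natrD natrM.
have [nw nwE] : exists nw : nat, (nw%:R : R) = m%:R * (L%:R + 500).
  by exists (m * (L + 500))%N; rewrite natrM natrD.
have M1 : 1 <= (m%:R : R) by rewrite ler1n.
have M0 : 0 < (m%:R : R) by apply: lt_le_trans M1.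
have rm : m%:R^-1 <= rho by rewrite -[rho]invrK lef_pV2 ?posrE ?invr_gt0// ltW.
have DR : 1 <= (D%:R : R) by rewrite ler1n.
have tr (x : R) : 0 <= x -> (Num.truncn x)%:R <= x /\ x < (Num.truncn x)%:R + 1.
  by move=> x0; have /andP[h1 h2] := truncn_itv x0; rewrite natr1; split.
have trlt (x : R) (n : nat) : 0 <= x -> x < n%:R -> (Num.truncn x < n)%N.
  by move=> x0 xn; rewrite truncn_lt_nat.
have trge (x : R) (n : nat) : n%:R <= x -> (n <= Num.truncn x)%N.
  by move=> xn; rewrite truncn_ge_nat// (le_trans _ xn).
have xb (x : R) : 9 <= x < 18 -> [/\ 0 <= m%:R * x, m%:R * x < (27 * m)%:R,
     (9 * m)%:R <= m%:R * x & m%:R * x < (18 * m)%:R].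
  move=> /andP[h1 h2]; rewrite !natrM [m%:R * x]mulrC.
  by split; rewrite ?mulr_ge0 ?ler_pM2r ?ltr_pM2r//; lra.
have ux1 i : (Num.truncn (m%:R * x1 i) < 27 * m)%N by have [? ? _ _] := xb _ (hx1 i); exact: trlt.
have ux2 i : (Num.truncn (m%:R * x2 i) < 27 * m)%N by have [? ? _ _] := xb _ (hx2 i); exact: trlt.
have zb i : 0 <= m%:R * (z i + L%:R) /\ m%:R * (z i + L%:R) < nw%:R.
  have /andP[h1 h2] := hz i.
  by split; rewrite ?mulr_ge0// ?nwE ?ltr_pM2l// LE; lra.
have uz i : (Num.truncn (m%:R * (z i + L%:R)) < nw)%N by have [? ?] := zb i; exact: trlt.
pose u1 i : 'I_(27 * m) := Ordinal (ux1 i).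
pose u2 i : 'I_(27 * m) := Ordinal (ux2 i).
pose w i : 'I_nw := Ordinal (uz i).
pose k1 j := Num.truncn (m%:R * y1 j).
pose k2 j := Num.truncn (m%:R * y2 j).
pose Th j := Num.truncn (m%:R * (th j + L%:R)).
have yb (y : R) : 0 <= y < 1 -> 0 <= m%:R * y /\ m%:R * y < m%:R.
  by move=> /andP[h1 h2]; rewrite mulr_ge0 ?gtr_pMr.
have k1m j : (k1 j < m)%N by have [? ?] := yb _ (hy1 j); exact: trlt.
have k2m j : (k2 j < m)%N by have [? ?] := yb _ (hy2 j); exact: trlt.
have u1m i : (9 * m <= u1 i < 18 * m)%N.
  by have [? ? ? ?] := xb _ (hx1 i); apply/andP; split; [exact: trge | exact: trlt].
have u2m i : (9 * m <= u2 i < 18 * m)%N.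
  by have [? ? ? ?] := xb _ (hx2 i); apply/andP; split; [exact: trge | exact: trlt].
have thb j : 0 <= m%:R * (th j + L%:R).
  by have /andP[h1 h2] := hth j; rewrite mulr_ge0// addr_ge0.
have Thm j : (108 * m + 2 * (84 + 6) * D <= Th j)%N && (Th j + (84 + 6) < nw)%N.
  have /andP[h1 h2] := hth j; apply/andP; split.
    have -> : (108 * m + 2 * (84 + 6) * D = 108 * m + 180 * D)%N by [].
    apply: trge; rewrite natrD !natrM.
    have : m%:R * (108 + 180 * D%:R) <= m%:R * (th j + L%:R) by rewrite ler_pM2l// LE; lra.
    apply: le_trans; rewrite mulrDr [m%:R * 108]mulrC lerD2l.
    by rewrite ler_peMl// -natrM ler0n.
  rewrite -(ltr_nat R) natrD; apply: le_lt_trans (lerD (tr _ (thb j)).1 (lexx _)) _.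
  apply: (@le_lt_trans _ _ (m%:R * (th j + L%:R) + 90 * m%:R)).
    by rewrite lerD2l -[leLHS]/(90 : R) ler_peMr.
  by rewrite mulrC -mulrDl mulrC nwE ltr_pM2l// LE; lra.
have cellP (x c : R) : c <= m%:R * x -> m%:R * x < c + 1 -> `|x - c / m%:R| <= rho.
  move=> h1 h2; apply: le_trans rm.
  have -> : x - c / m%:R = (m%:R * x - c) / m%:R by rewrite mulrBl mulrAC divff ?mul1r// gt_eqF.
  rewrite normrM [ `|m%:R^-1|]ger0_norm ?invr_ge0 ?(ltW M0)// ler_piMl ?invr_ge0 ?(ltW M0)//.
  by rewrite ger0_norm ?subr_ge0//; lra.
have ha' Q c1 c2 : (#|[set j' | (key' j' == Q) && ((k1 j' == c1) && (k2 j' == c2))]| <= Num.truncn a)%N.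
  apply: trge; apply: le_trans (ha Q (c1%:R / m%:R) (c2%:R / m%:R)).
  rewrite ler_nat; apply: subset_leq_card; apply/fintype.subsetP => j; rewrite !inE.
  case/and3P => -> /eqP <- /eqP <- /=.
  have [p1 _] := yb _ (hy1 j); have [p2 _] := yb _ (hy2 j).
  have [q1 q2] := tr _ p1; have [q3 q4] := tr _ p2.
  by rewrite !cellP.
have hb' c : (#|[set i | (key i, (u1 i, (u2 i, w i))) == c]| <= Num.truncn b)%N.
  case: c => Q [c1 [c2 c3]].
  apply: trge; apply: le_trans (hb Q (c1%:R / m%:R) (c2%:R / m%:R) (c3%:R / m%:R - L%:R)).
  rewrite ler_nat; apply: subset_leq_card; apply/fintype.subsetP => i; rewrite !inE.
  case/eqP => -> <- <- <- /=.
  have [p1 _ _ _] := xb _ (hx1 i); have [p2 _ _ _] := xb _ (hx2 i); have [p3 _] := zb i.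
  have [q1 q2] := tr _ p1; have [q3 q4] := tr _ p2; have [q5 q6] := tr _ p3.
  rewrite eqxx !cellP//=.
  by rewrite opprB addrA cellP.
have := @high_low_discrete R I J S m D 84 nw _ _ k1 k2 Th key' u1 u2 w key m0 D0 k1m k2m u1m u2m Thm ha' hb'.
set s1 := \sum_i _; set s2 := \sum_i _ => main.
have tri (x y e f : R) : `|x - y| <= e -> `|y| <= f -> `|x| <= e + f.
  by move=> h1 h2; rewrite -[x](subrK y); apply: le_trans (ler_normD _ _) _; exact: lerD.
have key_close i j : `|m%:R ^+ 2 * t i j - (defect k1 k2 Th u1 u2 w i j)%:~R| <= 77 * m%:R.
  have [p1 _ _ _] := xb _ (hx1 i); have [p2 _ _ _] := xb _ (hx2 i); have [p3 _] := zb i.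
  have [q1 q2] := tr _ p1; have [q3 q4] := tr _ p2; have [q5 q6] := tr _ p3.
  have [p4 _] := yb _ (hy1 j); have [p5 _] := yb _ (hy2 j).
  have [q7 q8] := tr _ p4; have [q9 q10] := tr _ p5; have [q11 q12] := tr _ (thb j).
  have /andP[g1 g2] := hx1 i; have /andP[g3 g4] := hx2 i.
  have /andP[g5 g6] := hy1 j; have /andP[g7 g8] := hy2 j.
  have -> : (defect k1 k2 Th u1 u2 w i j)%:~R = m%:R * (Th j)%:R
     - 2 * ((u1 i)%:R * (k1 j)%:R + (u2 i)%:R * (k2 j)%:R) - m%:R * (w i)%:R :> R.
    by rewrite /defect; ring.
  have nn (x : R) : 9 <= x -> 0 <= x by apply: le_trans.
  by apply: (@rounding_error R m%:R _ _ _ _ _ _ L%:R) => //; first [exact: nn | exact: ltW].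
have s1_ge : pair_count key key' t rho <= s1%:~R.
  rewrite /s1 /pair_count rmorph_sum /=; apply: ler_sum => i _.
  rewrite /near_count rmorph_sum /=; apply: ler_sum => j _.
  have := key_close i j; set d := defect _ _ _ _ _ _ _ _ => hd.
  have [ht|_] := boolP (`|t i j| <= rho)%R; last by rewrite ler0z.
  suff -> : `|d| <= 84%N%:Z * m%:Z by [].
  rewrite -(ler_int R) intr_norm intrM.
  have : `|m%:R ^+ 2 * t i j| <= 2 * m%:R.
    rewrite normrM ger0_norm ?sqr_ge0// expr2.
    apply: (@le_trans _ _ (m%:R * m%:R * rho)); first by rewrite ler_wpM2l// mulr_ge0.
    by rewrite mulrAC ler_wpM2r// -(ler_pM2r (_ : 0 < rho^-1)) ?invr_gt0// mulfK ?gt_eqF.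
  move=> h; rewrite distrC in hd; apply: le_trans (tri _ _ _ _ hd h) _.
  by rewrite -[84%N%:~R]/(84 : R) -[m%:~R]/(m%:R : R) -mulrDl ler_wpM2r//; lra.
have s2_le : s2%:~R <= pair_count key key' t (300 * D%:R * rho).
  rewrite /s2 /pair_count rmorph_sum /=; apply: ler_sum => i _.
  rewrite /near_count rmorph_sum /=; apply: ler_sum => j _.
  have := key_close i j; set d := defect _ _ _ _ _ _ _ _ => hd.
  have [|_] := boolP (`|d| <= _); last by rewrite ler0n.
  rewrite -(ler_int R) intr_norm intrM -[(2 * (84 + 6) * D + 5)%N]/(180 * D + 5)%N.
  rewrite -[(180 * D + 5)%N%:~R]/((180 * D + 5)%N%:R : R) natrD natrM -[m%:~R]/(m%:R : R) => hd2.
  suff -> : (`|t i j| <= 300 * D%:R * rho)%R by [].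
  have : `|m%:R ^+ 2 * t i j| <= (180 * D%:R + 82) * m%:R.
    have e1 : (180 * D%:R + 5) * m%:R + 77 * m%:R = (180 * D%:R + 82) * m%:R :> R by ring.
    by rewrite -e1 addrC; apply: tri hd hd2.
  rewrite normrM ger0_norm ?sqr_ge0// => h.
  have h2 : `|t i j| * m%:R <= 180 * D%:R + 82 by rewrite -(ler_pM2r M0) -mulrA -expr2 mulrC.
  rewrite -ler_pdivlMr// in h2; apply: le_trans h2 _.
  apply: (@le_trans _ _ ((180 * D%:R + 82) * rho)).
    by rewrite ler_wpM2l// addr_ge0// mulr_ge0.
  by rewrite ler_wpM2r ?ltW//; move: DR; clear; lra.
have D0' : 0 < (D%:R : R) by apply: lt_le_trans DR.
apply: le_trans (ler_wpM2l (ltW D0') s1_ge) _; apply: le_trans main _.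
apply: lerD => //.
have Hm := harmonic_le R m0.
have lnm : ln (m%:R : R) <= 1 - ln rho.
  apply: (@le_trans _ _ (ln (2 * rho^-1))); first by rewrite ler_ln ?posrE// mulr_gt0 ?invr_gt0.
  rewrite lnM ?posrE ?invr_gt0// lnV ?posrE// lerD2r.
  by have := @le_ln1Dx R 1; apply; lra.
have H0 : 0 <= harmonic R m by apply: sumr_ge0 => i _; rewrite invr_ge0.
set C : R := (kernel_const _ _ _)%:~R.
have C0 : 0 <= C by rewrite ler0z /kernel_const; clear; nonneg.
rewrite sqrtrM// /step_const -/C.
have -> : 4 * Num.sqrt C * rho^-1 * (3 - ln rho) * Num.sqrt (a * b * (#|I|%:R * #|J|%:R)) =
   (2 * rho^-1) * (2 * (3 - ln rho)) * (Num.sqrt C * Num.sqrt (a * b * (#|I|%:R * #|J|%:R))) by ring.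
have ta (x : R) : 0 <= x -> (Num.truncn x)%:R <= x by move=> /tr[].
apply: ler_pM; rewrite ?mulr_ge0 ?sqrtr_ge0//.
  apply: ler_pM; rewrite ?mulr_ge0// ler_pM2l//; lra.
rewrite ler_wpM2l ?sqrtr_ge0// ler_sqrt ?mulr_ge0// ler_wpM2r ?mulr_ge0//.
by apply: ler_pM => //; exact: ta.
Qed.

(** * Iterating over scales *)

Lemma log_le_powR (R : realType) (eps delta : R) :
  0 < eps -> 0 < delta -> delta < 1 ->
  3 - ln delta <= (3 + eps^-1) * delta `^ (- eps).
Proof.
move=> e0 d0 d1.
have l0 : 0 <= - ln delta by rewrite oppr_ge0 ln_le0// ltW.
have h : 1 + eps * (- ln delta) <= delta `^ (- eps).
  rewrite /powR gt_eqF// mulNr -mulrN.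
  exact: expR_ge1Dx.
rewrite mulrDl lerD//.
  by rewrite ler_peMr//; apply: le_trans h; rewrite lerDl mulr_ge0// ltW.
rewrite ler_pdivlMl//; apply: le_trans h; lra.
Qed.

Lemma iterate_le (R : realFieldType) (n : nat -> R) (D E : R) (K : nat) :
  0 < D ->
  (forall k, (k < K)%N -> D * n k <= n k.+1 + D * (D ^+ k * E)) ->
  n 0%N <= (D ^+ K)^-1 * n K + K%:R * E.
Proof.
move=> D0; elim: K => [|K IH] h; first by rewrite expr0 invr1 mul1r mul0r addr0.
apply: le_trans (IH _) _; first by move=> k kK; apply: h; apply: ltnW.
have hK := h K (ltnSn K).
have DK : 0 < D ^+ K by rewrite exprn_gt0.
rewrite -natr1 mulrDl mul1r [K%:R * E + E]addrC addrA lerD2r.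
rewrite -(ler_pM2l (exprn_gt0 K.+1 D0)).
have -> : D ^+ K.+1 * ((D ^+ K)^-1 * n K) = D * n K.
  by rewrite exprS -mulrA [D ^+ K * _]mulrA divff ?gt_eqF// mul1r.
have -> // : D ^+ K.+1 * ((D ^+ K.+1)^-1 * n K.+1 + E) = n K.+1 + D * (D ^+ K * E).
by rewrite mulrDr; congr (_ + _); [rewrite mulrA divff ?mul1r ?gt_eqF ?exprn_gt0 | rewrite exprS mulrA].
Qed.

(** Z is left abstract because its best value depends on the sign of (alpha + beta) / 2 - 2 and on
    where the iteration stops. One logarithm comes from each step and the other from the number of
    steps; 1728 = 12^3 bounds 12^((alpha + beta) / 2). The factor q^eps pays for the last scale,
    since only q^(K-1) is known to be at most delta^-1. *)
Lemma multiscale (R : realType) (I J S : finType) (x1 x2 z : I -> R)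
    (y1 y2 th : J -> R) (key : I -> S) (key' : J -> S) (D K : nat)
    (alpha beta delta eps A B Z q : R) :
  (0 < D)%N -> 0 < delta -> delta < 1 -> 0 < eps ->
  0 <= alpha + beta -> alpha + beta <= 6 ->
  q = 300 * D%:R -> 300 <= q `^ eps ->
  (forall i, 9 <= x1 i < 18) -> (forall i, 9 <= x2 i < 18) -> (forall i, -50 <= z i <= 50) ->
  (forall j, 0 <= y1 j < 1) -> (forall j, 0 <= y2 j < 1) -> (forall j, 0 <= th j <= 100) ->
  0 <= A -> 0 <= B ->
  (forall rho Q c1 c2, delta <= rho -> rho <= 1 ->
    #|[set j | [&& key' j == Q, `|y1 j - c1| <= rho & `|y2 j - c2| <= rho]]|%:R
      <= A * (rho / delta) `^ alpha) ->
  (forall rho Q c1 c2 c3, delta <= rho -> rho <= 1 ->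
    #|[set i | [&& key i == Q, `|x1 i - c1| <= rho, `|x2 i - c2| <= rho
      & `|z i - c3| <= rho]]|%:R <= B * (rho / delta) `^ beta) ->
  (forall k, (k < K)%N -> 12 * delta * q ^+ k <= 1) ->
  (forall k, (k < K)%N -> (q ^+ k) `^ ((alpha + beta) / 2 - 2) <= Z) ->
  0 <= Z ->
  pair_count key key' (cone_defect x1 x2 z y1 y2 th) (12 * delta) <=
  delta `^ (- eps) *
   (q `^ eps * (q ^+ K)^-1 *
      pair_count key key' (cone_defect x1 x2 z y1 y2 th) (12 * delta * q ^+ K)
    + 1728 * step_const R D * (3 - ln delta) ^+ 2 * delta^-1 * Z
      * Num.sqrt (A * B * (#|I|%:R * #|J|%:R))).
Proof.
move=> D0 d0 d1 e0 ab0 ab6 qE q300 hx1 hx2 hz hy1 hy2 hth A0 B0 hA hB hK hZ Z0.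
set t := cone_defect _ _ _ _ _ _.
have DR : 1 <= (D%:R : R) by rewrite ler1n.
have D0' : 0 < (D%:R : R) by rewrite ltr0n.
have p300 : 0 < 300 :> R by rewrite ltr0n.
have p300' : 0 <= 300 :> R by rewrite ler0n.
have p12 : 0 < 12 :> R by rewrite ltr0n.
have p1728 : 0 <= 1728 :> R by rewrite ler0n.
have q1 : 300 <= q by rewrite qE ler_peMr.
have q0 : 0 < q by apply: lt_le_trans q1.
have qk0 k : 0 < q ^+ k by rewrite exprn_gt0.
have qk1 k : 1 <= q ^+ k by rewrite exprn_ege1//; apply: le_trans q1; lra.
have sc0 : 0 <= step_const R D by rewrite mulr_ge0// sqrtr_ge0.
have l0 : 0 <= - ln delta by rewrite oppr_ge0 ln_le0// ltW.
pose l := 3 - ln delta.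
have l3 : 3 <= l by rewrite /l; lra.
pose sg := (alpha + beta) / 2.
pose X := A * B * (#|I|%:R * #|J|%:R).
have X0 : 0 <= X by rewrite !mulr_ge0.
pose de := delta `^ (- eps).
have de0 : 0 < de by rewrite powR_gt0.
pose E := de * (1728 * step_const R D * l * delta^-1 * Z * Num.sqrt X).
pose n k := pair_count key key' t (12 * delta * q ^+ k).
have hq k : (k < K)%N -> q ^+ k <= delta^-1.
  move=> kK; rewrite -[_^-1]mul1r ler_pdivlMr//; apply: le_trans (hK k kK).
  by rewrite mulrC -mulrA ler_peMl ?mulr_ge0 ?(ltW d0) ?(ltW (qk0 k))// ler1n.
have qde k : (k < K)%N -> (q ^+ k) `^ eps <= de.
  move=> kK; have -> : de = (delta^-1) `^ eps.
    by rewrite /de -powR_inv1 ?(ltW d0)// -powRrM mulN1r.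
  by rewrite ge0_ler_powR ?nnegrE ?invr_ge0 ?(ltW e0) ?(ltW d0) ?(ltW (qk0 k)) ?hq.
have D300 k : 300 ^+ k <= (q ^+ k) `^ eps.
  rewrite -[q ^+ k]powR_mulrn ?(ltW q0)// powRAC powR_mulrn ?powR_ge0//.
  by rewrite lerXn2r ?nnegrE ?powR_ge0.
have Dk k : (D%:R ^+ k)^-1 = 300 ^+ k * (q ^+ k)^-1 :> R.
  by rewrite qE exprMn invfM mulrA (divff (expf_neq0 k (lt0r_neq0 p300))) mul1r.
have steps k : (k < K)%N -> D%:R * n k <= n k.+1 + D%:R * (D%:R ^+ k * E).
  move=> kK; have r1 := hK k kK; set rho := 12 * delta * q ^+ k in r1.
  have r0 : 0 < rho by rewrite !mulr_gt0.
  have rd : delta <= rho.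
    by rewrite /rho -mulrA mulrCA ler_peMr ?(ltW d0)// (le_trans (qk1 k))// ler_peMl ?ler1n ?(ltW (qk0 k)).
  have hA' Q c1 c2 := hA rho Q c1 c2 rd r1.
  have hB' Q c1 c2 c3 := hB rho Q c1 c2 c3 rd r1.
  have AA : 0 <= A * (rho / delta) `^ alpha by rewrite mulr_ge0// powR_ge0.
  have BB : 0 <= B * (rho / delta) `^ beta by rewrite mulr_ge0// powR_ge0.
  have := high_low_step D0 r0 r1 hx1 hx2 hz hy1 hy2 hth AA BB hA' hB'.
  rewrite -/t -qE.
  have -> : q * rho = 12 * delta * q ^+ k.+1 by rewrite /rho exprSr; ring.
  move/le_trans; apply; rewrite lerD2l.
  have rdE : rho / delta = 12 * q ^+ k.
    by rewrite /rho; field; rewrite gt_eqF.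
  have sqE : Num.sqrt (A * (rho / delta) `^ alpha * (B * (rho / delta) `^ beta) * (#|I|%:R * #|J|%:R))
     = 12 `^ sg * (q ^+ k) `^ sg * Num.sqrt X.
    have rp : 0 < rho / delta by rewrite divr_gt0.
    have -> : A * (rho / delta) `^ alpha * (B * (rho / delta) `^ beta) * (#|I|%:R * #|J|%:R)
       = ((rho / delta) `^ sg) ^+ 2 * X.
      rewrite -powR_mulrn ?powR_ge0// -powRrM /sg divfK// powRD; last by rewrite (gt_eqF rp) implybT.
      by rewrite /X; ring.
    by rewrite sqrtrM ?sqr_ge0// sqrtr_sqr ger0_norm ?powR_ge0// rdE powRM ?(ltW p12) ?(ltW (qk0 k)).
  rewrite sqE.
  have lr : 3 - ln rho <= l by rewrite lerD2l lerN2 ler_ln ?posrE.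
  have lr0 : 0 <= 3 - ln rho by rewrite subr_ge0 (le_trans (ln_le0 r1)).
  have p12sg : 12 `^ sg <= 1728 :> R.
    have -> : 1728 = 12 `^ 3%:R :> R by rewrite powR_mulrn// ; ring.
    have sg3 : sg <= 3 by rewrite /sg; move: ab6; clear; lra.
    by apply: ler_powR; [rewrite ler1n | exact: sg3].
  have c1 : (D%:R ^+ k)^-1 <= de * (q ^+ k)^-1 :> R.
    by rewrite Dk ler_wpM2r ?invr_ge0 ?(ltW (qk0 k))// (le_trans (D300 k)) ?qde.
  have c2 : rho^-1 <= delta^-1 * (q ^+ k)^-1.
    have dq : 0 < delta * q ^+ k by rewrite mulr_gt0.
    by rewrite -invfM lef_pV2 ?posrE// /rho -mulrA ler_peMl ?ler1n ?(ltW dq).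
  (* The square cancels the two factors q^-k of [c1] and [c2]. *)
  have c3 : (q ^+ k) `^ sg = (q ^+ k) ^+ 2 * (q ^+ k) `^ (sg - 2).
    rewrite -[(q ^+ k) ^+ 2]powR_mulrn ?(ltW (qk0 k))// -powRD ?subrKC//.
    by rewrite (gt_eqF (qk0 k)) implybT.
  have c4 : (q ^+ k) `^ (sg - 2) <= Z by exact: hZ.
  apply: (@le_trans _ _ (D%:R ^+ k * E)); last first.
    by rewrite ler_peMl// !mulr_ge0 ?exprn_ge0 ?invr_ge0 ?sqrtr_ge0 ?(ltW d0) ?(ltW de0)// (le_trans _ l3).
  rewrite -ler_pdivrMl ?exprn_gt0//.
  apply: (@le_trans _ _ (de * (q ^+ k)^-1 * (step_const R D * (delta^-1 * (q ^+ k)^-1) * l *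
     (1728 * ((q ^+ k) ^+ 2 * Z) * Num.sqrt X)))).
    have i1 : 0 <= (D%:R ^+ k)^-1 :> R by rewrite invr_ge0 exprn_ge0.
    have i2 : 0 <= step_const R D * rho^-1 by rewrite mulr_ge0// invr_ge0 (ltW r0).
    have i4 : 0 <= 12 `^ sg * (q ^+ k) `^ sg * Num.sqrt X.
      by rewrite mulr_ge0 ?sqrtr_ge0// mulr_ge0 ?powR_ge0.
    have i5 : 0 <= step_const R D * rho^-1 * (3 - ln rho) by rewrite mulr_ge0.
    apply: ler_pM => //; first by rewrite mulr_ge0.
    apply: ler_pM => //; first by apply: ler_pM => //; rewrite ler_wpM2l.
    rewrite ler_wpM2r ?sqrtr_ge0//; apply: ler_pM; rewrite ?powR_ge0//.
    by rewrite c3 ler_wpM2l// exprn_ge0 ?(ltW (qk0 k)).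
  rewrite le_eqVlt; apply/orP; left; apply/eqP; rewrite /E.
  have qn : q ^+ k != 0 by rewrite gt_eqF.
  have dn : delta != 0 by rewrite gt_eqF.
  by field; apply/andP; split.
have := iterate_le D0' steps.
rewrite /n expr0 mulr1 => /le_trans; apply.
rewrite -/de mulrDr lerD//.
  rewrite !mulrA ler_wpM2r//.
    by apply: sumr_ge0 => i _; apply: sumr_ge0.
  rewrite Dk ler_wpM2r ?invr_ge0 ?(ltW (qk0 K))//.
  case: K {hK hZ hq steps} qde => [|K] qde.
    have d1' : 1 <= de.
      by rewrite /de -(powRr0 delta); apply: ger_powR; rewrite ?d0 ?(ltW d1)// oppr_le0 ltW.
    have h : 1 <= q `^ eps by apply: le_trans q300; rewrite ler1n.
    by rewrite [300 ^+ 0]expr0; exact: mulr_ege1.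
  rewrite [300 ^+ _]exprSr; apply: ler_pM.
  - exact: exprn_ge0.
  - exact: p300'.
  - exact: le_trans (D300 K) (qde K (ltnSn K)).
  - exact: q300.
rewrite -/l -/X.
(* As ln q >= ln 4 >= 1, one has K - 1 <= ln (q^(K-1)) <= - ln delta when K > 0. *)
have Kl : K%:R <= l.
  case: K hK hq {hZ qde steps n} => [|K] hK hq; first by apply: le_trans l3.
  have h := hK K (ltnSn K).
  have h2 : K%:R <= ln (q ^+ K).
    rewrite lnXn// -[ln q *+ K]mulr_natl ler_peMr//.
    have q4 : 1 <= ln (2 ^+ 2 : R).
      have := @le_ln1Dx R (- 2^-1); have -> : 1 + - 2^-1 = 2^-1 :> R by field.
      by rewrite lnV ?posrE// lnXn// -[ln 2 *+ 2]mulr_natl => h2; lra.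
    apply: le_trans q4 _; rewrite ler_ln ?posrE ?exprn_gt0//.
    by apply: le_trans q1; rewrite -natrX ler_nat.
  have h3 : ln (q ^+ K) <= - ln delta.
    by rewrite -lnV ?posrE// ler_ln ?posrE ?invr_gt0//; exact: hq.
  by rewrite -natr1 /l; lra.
have -> : de * (1728 * step_const R D * l ^+ 2 * delta^-1 * Z * Num.sqrt X) = l * E.
  by rewrite /E; ring.
rewrite ler_wpM2r// /E !mulr_ge0 ?sqrtr_ge0 ?(ltW de0) ?invr_ge0 ?(ltW d0)//.
by apply: le_trans l3.
Qed.

(** * Localisation to unit squares *)

Section Localisation.
Variables (R : realType) (I J : finType) (X1 X2 r : I -> R) (Y1 Y2 : J -> R).
Variables (delta alpha beta A B : R) (inc : I -> J -> bool).
Hypotheses (d0 : 0 < delta) (d1 : delta < 1).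
Hypotheses (hr : forall i, 1 <= r i <= 2).
Hypotheses (beta0 : 0 <= beta) (beta3 : beta <= 3).
Hypotheses (A0 : 0 <= A) (B0 : 0 <= B).
Hypothesis hA : forall rho c1 c2, delta <= rho ->
  #|[set j | `|Y1 j - c1| <= rho & `|Y2 j - c2| <= rho]|%:R <= A * (rho / delta) `^ alpha.
Hypothesis hB : forall rho c1 c2 c3, delta <= rho ->
  #|[set i | [&& `|X1 i - c1| <= rho, `|X2 i - c2| <= rho & `|r i - c3| <= rho]]|%:R
    <= B * (rho / delta) `^ beta.
Hypothesis hinc : forall i j, inc i j ->
  [/\ `|(X1 i - Y1 j) ^+ 2 + (X2 i - Y2 j) ^+ 2 - r i ^+ 2| <= 12 * delta,
      `|X1 i - Y1 j| <= 4 & `|X2 i - Y2 j| <= 4].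

(* Each circle is replicated for the 81 unit squares around its centre. *)
Let I' : finType := (I * ('I_9 * 'I_9))%type.
Let ikey (i : I') : int * int :=
  (Num.floor (X1 i.1) + i.2.1%:Z - 4, Num.floor (X2 i.1) + i.2.2%:Z - 4).
Let jkey (j : J) : int * int := (Num.floor (Y1 j), Num.floor (Y2 j)).
(** Only the squares that occur are listed, which makes the keys a finite type although the plane
    has infinitely many squares. *)
Let keys := [seq ikey i | i <- enum I'] ++ [seq jkey j | j <- enum J].
Let ikeyP i : ikey i \in keys.
Proof. by rewrite mem_cat map_f ?mem_enum. Qed.
Let jkeyP j : jkey j \in keys.
Proof. by rewrite mem_cat (map_f jkey) ?mem_enum ?orbT. Qed.
Let S : finType := seq_sub keys.
Let key (i : I') : S := SeqSub (ikeyP i).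
Let key' (j : J) : S := SeqSub (jkeyP j).

Let w1 (i : I') : R := X1 i.1 - (ikey i).1%:~R.
Let w2 (i : I') : R := X2 i.1 - (ikey i).2%:~R.
(* The shift by 13 puts x in [9, 18), as the grid model wants; it is
   compensated by the linear term of [th]. *)
Let x1 i := w1 i + 13.
Let x2 i := w2 i + 13.
Let z (i : I') : R := r i.1 ^+ 2 - w1 i ^+ 2 - w2 i ^+ 2.
Let y1 (j : J) : R := Y1 j - (jkey j).1%:~R.
Let y2 (j : J) : R := Y2 j - (jkey j).2%:~R.
Let th (j : J) : R := y1 j ^+ 2 + y2 j ^+ 2 + 26 * (y1 j + y2 j).

Let frac_itv (x : R) : 0 <= x - (Num.floor x)%:~R < 1.
Proof.
have /andP[h1 h2] := floor_itv x; rewrite intrD in h2.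
by apply/andP; split; lra.
Qed.

Let off_itv (x : R) (v : 'I_9) :
  -4 <= x - (Num.floor x + v%:Z - 4)%:~R < 5.
Proof.
have /andP[h1 h2] := frac_itv x.
rewrite intrB intrD; have v8 : (v%:Z%:~R : R) <= 8.
  by rewrite -[8]/(8%N%:R) ler_nat -ltnS ltn_ord.
have v0 : 0 <= (v%:Z%:~R : R) by [].
by move: v8 v0 h1 h2; move: (v%:Z%:~R : R) ((Num.floor x)%:~R : R) => a b *; apply/andP; split; lra.
Qed.

Let w1_itv i : -4 <= w1 i < 5. Proof. exact: off_itv. Qed.
Let w2_itv i : -4 <= w2 i < 5. Proof. exact: off_itv. Qed.

Let sqw (w : R) : -4 <= w < 5 -> w ^+ 2 <= 25.
Proof. by move=> /andP[h1 h2]; nra. Qed.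

Let hx1 i : 9 <= x1 i < 18.
Proof. by have /andP[h1 h2] := w1_itv i; rewrite /x1; apply/andP; split; lra. Qed.
Let hx2 i : 9 <= x2 i < 18.
Proof. by have /andP[h1 h2] := w2_itv i; rewrite /x2; apply/andP; split; lra. Qed.
Let hz i : -50 <= z i <= 50.
Proof.
have h1 := sqw (w1_itv i); have h2 := sqw (w2_itv i); have /andP[h3 h4] := hr i.1.
have h5 := sqr_ge0 (w1 i); have h6 := sqr_ge0 (w2 i).
have h7 := sqr_ge0 (r i.1).
have h8 : r i.1 ^+ 2 <= 4 by nra.
by rewrite /z; apply/andP; split; lra.
Qed.
Let hy1 j : 0 <= y1 j < 1. Proof. exact: frac_itv. Qed.
Let hy2 j : 0 <= y2 j < 1. Proof. exact: frac_itv. Qed.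
Let hth j : 0 <= th j <= 100.
Proof.
have /andP[h1 h2] := hy1 j; have /andP[h3 h4] := hy2 j.
rewrite /th; move: (y1 j) (y2 j) h1 h2 h3 h4 => a b *.
by apply/andP; split; nra.
Qed.

Let class_j rho Q c1 c2 : delta <= rho ->
  #|[set j | [&& key' j == Q, `|y1 j - c1| <= rho & `|y2 j - c2| <= rho]]|%:R
      <= A * (rho / delta) `^ alpha.
Proof.
move=> dr; apply: le_trans (hA (c1 + (ssval Q).1%:~R) (c2 + (ssval Q).2%:~R) dr).
rewrite ler_nat; apply: subset_leq_card; apply/fintype.subsetP => j; rewrite !inE.
case/and3P => /eqP <- /= h1 h2.
have e (a b c : R) : a - (b + c) = a - c - b by ring.
by rewrite !e h1 h2.
Qed.

(** Two copies of one circle with the same key coincide, so a class with a fixed key injects into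
    [I]: replication does not increase the number of circles in a cell. *)
Let class_i_card (rho : R) (Q : S) (P : pred I') (c1 c2 c3 : R) :
  (forall i, P i -> [/\ key i = Q, `|X1 i.1 - c1| <= rho, `|X2 i.1 - c2| <= rho
     & `|r i.1 - c3| <= rho]) -> delta <= rho ->
  #|[set i | P i]|%:R <= B * (rho / delta) `^ beta.
Proof.
move=> hP dr; apply: le_trans (hB c1 c2 c3 dr); rewrite ler_nat.
have inj : {in [set i | P i] &, injective (fun i : I' => i.1)}.
  move=> [i [v1 v2]] [i' [v1' v2']]; rewrite !inE => /hP[k1 _ _ _] /hP[k2 _ _ _] /= e.
  have := congr1 (@ssval _ _) (etrans k1 (esym k2)); rewrite /= /ikey /= -e => -[e1 e2].
  by congr (_, (_, _)) => //; apply: val_inj => /=; lia.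
rewrite -(card_in_imset inj); apply: subset_leq_card.
apply/fintype.subsetP => i /imsetP[i']; rewrite inE => /hP[_ h1 h2 h3] ->.
by rewrite inE h1 h2 h3.
Qed.

Let powR_scale (c rho : R) : 1 <= c -> delta <= rho ->
  (c * rho / delta) `^ beta <= c ^+ 3 * (rho / delta) `^ beta.
Proof.
move=> c1 dr; have c0 : 0 <= c by apply: le_trans c1.
have r0 : 0 <= rho / delta by rewrite divr_ge0// ltW// (lt_le_trans d0).
rewrite -mulrA powRM// ler_wpM2r ?powR_ge0// -powR_mulrn//.
exact: ler_powR.
Qed.

(** Within one square, r is recovered from (x, z) at bounded cost because r >= 1: the differences of
    z, w1^2 and w2^2 give |r^2 - r'^2| <= 2 rho + 20 rho + 20 rho, and dividing by r + r' >= 2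
    leaves 21 rho. *)
Let class_i rho Q c1 c2 c3 : delta <= rho ->
  #|[set i | [&& key i == Q, `|x1 i - c1| <= rho, `|x2 i - c2| <= rho
      & `|z i - c3| <= rho]]|%:R <= 21 ^+ 3 * B * (rho / delta) `^ beta.
Proof.
move=> dr; have r0 : 0 < rho by apply: lt_le_trans d0 dr.
set P := fun i => [&& _, _, _ & _].
(* The box is recentred at one of its members, because c3 is a value of z and not a radius. *)
have [i0 Pi0|noP] := pickP P; last first.
  rewrite (_ : [set i | P i] = finset.set0); last by apply/setP => i; rewrite !inE noP.
  by rewrite cards0 !mulr_ge0 ?powR_ge0 ?exprn_ge0.
have dr21 : delta <= 21 * rho by apply: le_trans dr _; rewrite ler_peMl ?ler1n ?ltW.
rewrite [21 ^+ 3 * B]mulrC -mulrA.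
apply: le_trans (_ : B * (21 * rho / delta) `^ beta <= _); last first.
  by rewrite ler_wpM2l// powR_scale// ler1n.
apply: (@class_i_card _ Q P (X1 i0.1) (X2 i0.1) (r i0.1)) => // i Pi.
move: Pi Pi0 => /and4P[/eqP kQ a1 a2 a3] /and4P[/eqP kQ0 b1 b2 b3].
have ke : ikey i = ikey i0 by have := congr1 (@ssval _ _) (etrans kQ (esym kQ0)).
have tri (a b c : R) : `|a - c| <= rho -> `|b - c| <= rho -> `|a - b| <= 2 * rho.
  move=> h1 h2; have -> : a - b = (a - c) - (b - c) by ring.
  by apply: le_trans (ler_normB _ _) _; rewrite mulrDl mul1r lerD.
have t1 := tri _ _ _ a1 b1; have t2 := tri _ _ _ a2 b2; have t3 := tri _ _ _ a3 b3.
have e1 : x1 i - x1 i0 = X1 i.1 - X1 i0.1 by rewrite /x1 /w1 ke; ring.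
have e2 : x2 i - x2 i0 = X2 i.1 - X2 i0.1 by rewrite /x2 /w2 ke; ring.
have g1 : w1 i - w1 i0 = X1 i.1 - X1 i0.1 by rewrite /w1 ke; ring.
have g2 : w2 i - w2 i0 = X2 i.1 - X2 i0.1 by rewrite /w2 ke; ring.
rewrite e1 in t1; rewrite e2 in t2.
have two : 2 * rho <= 21 * rho by rewrite ler_wpM2r ?(ltW r0)// ler_nat.
split => //; rewrite ?(le_trans t1)// ?(le_trans t2)//.
have sq (a b : R) : -4 <= a < 5 -> -4 <= b < 5 -> `|a - b| <= 2 * rho ->
    `|a ^+ 2 - b ^+ 2| <= 20 * rho.
  move=> /andP[h1 h2] /andP[h3 h4] h; rewrite subr_sqr normrM.
  have -> : 20 * rho = 2 * rho * 10 by ring.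
  by apply: ler_pM => //; rewrite ler_norml; apply/andP; split; lra.
have s1 := sq _ _ (w1_itv i) (w1_itv i0) ltac:(by rewrite g1).
have s2 := sq _ _ (w2_itv i) (w2_itv i0) ltac:(by rewrite g2).
have rr : `|r i.1 ^+ 2 - r i0.1 ^+ 2| <= 42 * rho.
  have -> : r i.1 ^+ 2 - r i0.1 ^+ 2 = (z i - z i0) + (w1 i ^+ 2 - w1 i0 ^+ 2) +
     (w2 i ^+ 2 - w2 i0 ^+ 2) by rewrite /z; ring.
  have -> : 42 * rho = 2 * rho + 20 * rho + 20 * rho by ring.
  by apply: le_trans (ler_normD _ _) _; apply: lerD => //; apply: le_trans (ler_normD _ _) _; apply: lerD.
have /andP[r1 _] := hr i.1; have /andP[r2 _] := hr i0.1.
have rs : 2 <= `|r i.1 + r i0.1| by rewrite ger0_norm; lra.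
rewrite subr_sqr normrM in rr.
rewrite -(@ler_pM2r _ 2)//; apply: le_trans (_ : `|r i.1 - r i0.1| * `|r i.1 + r i0.1| <= _).
  by rewrite ler_wpM2l.
by apply: le_trans rr _; rewrite mulrAC -natrM.
Qed.

Let t := cone_defect x1 x2 z y1 y2 th.
Let N : R := \sum_i \sum_j (inc i j)%:R.

Let tE i j : key' j = key i ->
  t i j = (X1 i.1 - Y1 j) ^+ 2 + (X2 i.1 - Y2 j) ^+ 2 - r i.1 ^+ 2.
Proof.
move=> /(congr1 (@ssval _ _)) /= e.
have e1 : (jkey j).1 = (ikey i).1 by rewrite e.
have e2 : (jkey j).2 = (ikey i).2 by rewrite e.
rewrite /t /cone_defect /th /z /x1 /x2 /y1 /y2 /w1 /w2 e1 e2; ring.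
Qed.

(** Incident objects have centres within 4 in each coordinate, so the floors differ by at most 4 and
    one of the 9 by 9 copies of the circle carries the key of the disc. *)
Lemma incidences_le_pair_count : N <= pair_count key key' t (12 * delta).
Proof.
rewrite /N /pair_count sum_pair; apply: ler_sum => i _.
rewrite [leRHS](exchange_big_dep xpredT)//=; apply: ler_sum => j _.
have [ij|_] := boolP (inc i j); last by apply: sumr_ge0.
have [h1 h2 h3] := hinc ij.
have off (x y : R) : `|x - y| <= 4 -> (0 <= Num.floor y - Num.floor x + 4 < 9)%R.
  move=> h; have /andP[a1 a2] := frac_itv x; have /andP[b1 b2] := frac_itv y.
  have : ((Num.floor y - Num.floor x + 4)%:~R : R) < 9%:~R /\
     (-1)%:~R < ((Num.floor y - Num.floor x + 4)%:~R : R).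
    rewrite intrD intrB; move: h; rewrite ler_norml => /andP[h h'].
    move: a1 a2 b1 b2; move: ((Num.floor x)%:~R : R) ((Num.floor y)%:~R : R) => p q.
    rewrite -[4%:~R]/(4 : R) -[9%:~R]/(9 : R) -[(-1)%:~R]/(-1 : R) => *; split; lra.
  rewrite !(@ltr_int R) => -[c1 c2]; apply/andP; move: c1 c2; clear; split; lia.
have o1 := off _ _ h2; have o2 := off _ _ h3.
have v1P : (absz (Num.floor (Y1 j) - Num.floor (X1 i) + 4)%R < 9)%N by move: o1; clear; lia.
have v2P : (absz (Num.floor (Y2 j) - Num.floor (X2 i) + 4)%R < 9)%N by move: o2; clear; lia.
pose v := (Ordinal v1P, Ordinal v2P).
have kv : key' j = key (i, v).
  by apply: val_inj; rewrite /= /ikey /jkey /=; move: o1 o2; clear; move=> o1 o2; congr (_, _); lia.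
rewrite (bigD1 v) /=; last by rewrite kv.
by rewrite tE//= h1 lerDl sumr_ge0.
Qed.

Let pair_count_nonneg rho : 0 <= pair_count key key' t rho.
Proof. by apply: sumr_ge0 => i _; apply: sumr_ge0. Qed.

Lemma pair_count_trivial rho : pair_count key key' t rho <= 81 * (#|I|%:R * #|J|%:R).
Proof.
apply: (@le_trans _ _ (\sum_(i : I') \sum_(j : J) 1)).
  apply: ler_sum => i _; rewrite big_mkcond /=; apply: ler_sum => j _.
  by case: ifP => // _; rewrite -[leRHS]/(1%:R) ler_nat leq_b1.
rewrite sumr_const sumr_const !card_prod !card_ord -mulrnA !natrM.
by rewrite le_eqVlt; apply/orP; left; apply/eqP; ring.
Qed.

(** The geometric mean of two counts: for each circle copy, the discs in its unit square, and for
    each disc, the circles with a copy in its square. These lie in boxes of half-side 1 and 5, so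
    the bound is independent of rho and serves when the iteration reaches scale 1. *)
Lemma pair_count_local rho : pair_count key key' t rho <=
  9 * Num.sqrt (A * (21 ^+ 3 * B) * (#|I|%:R * #|J|%:R)) * delta `^ (- ((alpha + beta) / 2)).
Proof.
set P := pair_count _ _ _ _.
have P0 : 0 <= P by exact: pair_count_nonneg.
have b1 (b : bool) : b%:R <= 1 :> R by rewrite -[leRHS]/(1%:R) ler_nat leq_b1.
have di : 1 / delta = delta^-1 by rewrite mul1r.
have PI : P <= (81 * #|I|%:R) * (A * delta^-1 `^ alpha).
  have -> : 81 * #|I|%:R = #|I'|%:R :> R.
    by rewrite !card_prod !card_ord -natrM; congr (_%:R); rewrite mulnC.
  rewrite mulr_natl -sumr_const; apply: ler_sum => i _.
  apply: (@le_trans _ _ (\sum_(j | key' j == key i) 1)).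
    by apply: ler_sum => j _; exact: b1.
  rewrite sumr_const -di; apply: le_trans (@class_j 1 (key i) 0 0 (ltW d1)).
  rewrite ler_nat; apply: subset_leq_card; apply/fintype.subsetP => j; rewrite !inE.
  move=> hk; have /andP[a1 a2] := hy1 j; have /andP[a3 a4] := hy2 j.
  have {}hk : key' j == key i := hk.
  by rewrite hk !subr0 !ger0_norm// !ltW.
have PJ : P <= #|J|%:R * (21 ^+ 3 * B * delta^-1 `^ beta).
  rewrite /P /pair_count (exchange_big_dep xpredT)//= mulr_natl -sumr_const.
  apply: ler_sum => j _.
  apply: (@le_trans _ _ (\sum_(i | key' j == key i) 1)).
    by apply: ler_sum => i _; exact: b1.
  rewrite sumr_const -[X in X <= _]/(_%:R).
  have d5 : delta <= 5 by apply: le_trans (ltW d1) _; rewrite ler1n.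
  apply: (@le_trans _ _ (B * (5 / delta) `^ beta)).
    apply: le_trans (@class_i_card 5 (key' j) (fun i => key' j == key i)
        (jkey j).1%:~R (jkey j).2%:~R 0 _ d5).
      by rewrite ler_nat cardsE.
    move=> i /eqP e; have /(congr1 (@ssval _ _)) /= e' := e.
    have /andP[h1 h2] : -4 <= X1 i.1 - (jkey j).1%:~R < 5 by rewrite e'; exact: w1_itv.
    have /andP[h3 h4] : -4 <= X2 i.1 - (jkey j).2%:~R < 5 by rewrite e'; exact: w2_itv.
    have /andP[h5 h6] := hr i.1.
    split => //; rewrite ler_norml; apply/andP; split; rewrite ?subr0.
    - by apply: le_trans h1; rewrite lerN2 ler_nat.
    - exact: ltW.
    - by apply: le_trans h3; rewrite lerN2 ler_nat.
    - exact: ltW.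
    - by apply: (@le_trans _ _ 0); rewrite ?oppr_le0 ?ler0n// (le_trans _ h5).
    - by apply: le_trans h6 _; rewrite ler_nat.
  rewrite [21 ^+ 3 * B]mulrC -mulrA ler_wpM2l//.
  have := @powR_scale 5 1; rewrite mulr1 ler1n => /(_ isT (ltW d1)) /le_trans; apply.
  by rewrite di ler_wpM2r ?powR_ge0// -!natrX ler_nat.
have -> : delta `^ (- ((alpha + beta) / 2)) = delta^-1 `^ ((alpha + beta) / 2).
  by rewrite -[delta^-1]powR_inv1 ?(ltW d0)// -powRrM mulN1r.
set sg := (alpha + beta) / 2; set X := A * _ * _.
have X0 : 0 <= X by rewrite /X !mulr_ge0// exprn_ge0.
have PP : P ^+ 2 <= (9 * delta^-1 `^ sg) ^+ 2 * X.
  rewrite expr2; apply: le_trans (ler_pM P0 P0 PI PJ) _.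
  rewrite exprMn -[(_ `^ sg) ^+ 2]powR_mulrn ?powR_ge0// -powRrM /sg divfK// powRD; last first.
    by rewrite invr_eq0 (gt_eqF d0) implybT.
  by rewrite le_eqVlt; apply/orP; left; apply/eqP; rewrite /X; ring.
have D9 : 0 <= 9 * delta^-1 `^ sg by rewrite mulr_ge0// powR_ge0.
rewrite mulrAC -[P](ger0_norm P0) -sqrtr_sqr -{1}[9 * _](ger0_norm D9) -sqrtr_sqr.
by rewrite -sqrtrM ?sqr_ge0// ler_sqrt// mulr_ge0// sqr_ge0.
Qed.

Hypothesis alpha0 : 0 <= alpha.
Hypothesis alpha2 : alpha <= 2.
Let X : R := A * B * (#|I|%:R * #|J|%:R).
Let sg : R := (alpha + beta) / 2.

Let X0 : 0 <= X. Proof. by rewrite /X !mulr_ge0. Qed.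

(** The square root of the two losses of localisation: 21^3 in the spacing of the circles and 81 in
    their number. *)
Definition overlap_const : R := Num.sqrt (21 ^+ 3 * 81).

(** Both bounds for the last scale are kept in a minimum: the first is used when the iteration stops
    midway, the second when it reaches scale 1. *)
Lemma multiscale_incidences (D K : nat) (eps Z q : R) :
  (0 < D)%N -> 0 < eps -> q = 300 * D%:R -> 300 <= q `^ eps ->
  (forall k, (k < K)%N -> 12 * delta * q ^+ k <= 1) ->
  (forall k, (k < K)%N -> (q ^+ k) `^ (sg - 2) <= Z) -> 0 <= Z ->
  N <= delta `^ (- eps) * (q `^ eps * (q ^+ K)^-1 *
     Num.min (81 * (#|I|%:R * #|J|%:R)) (overlap_const * Num.sqrt X * delta `^ (- sg))
    + 1728 * step_const R D * (3 - ln delta) ^+ 2 * delta^-1 * Z * (overlap_const * Num.sqrt X)).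
Proof.
move=> D0 e0 qE q300 hK hZ Z0.
apply: le_trans incidences_le_pair_count _.
have B0' : 0 <= 21 ^+ 3 * B by rewrite mulr_ge0// exprn_ge0.
have ab0 : 0 <= alpha + beta by rewrite addr_ge0.
have ab6 : alpha + beta <= 6 by apply: le_trans (lerD alpha2 beta3) _; rewrite -natrD ler_nat.
have q0 : 0 <= q by rewrite qE -natrM ler0n.
have sc0 : 0 <= step_const R D by rewrite mulr_ge0// sqrtr_ge0.
apply: le_trans (@multiscale R I' J S x1 x2 z y1 y2 th key key' D K alpha beta delta eps A
  (21 ^+ 3 * B) Z q D0 d0 d1 e0 ab0 ab6 qE q300 hx1 hx2 hz hy1 hy2 hth A0 B0' _ _ hK hZ Z0) _.
- by move=> rho Q c1 c2 dr _; exact: class_j.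
- by move=> rho Q c1 c2 c3 dr _; exact: class_i.
apply: ler_wpM2l; first exact: powR_ge0.
apply: lerD.
  apply: ler_wpM2l; first by rewrite mulr_ge0 ?powR_ge0// invr_ge0 exprn_ge0.
  rewrite le_min; apply/andP; split; first exact: pair_count_trivial.
  apply: le_trans (pair_count_local _) _.
  rewrite ler_wpM2r ?powR_ge0//.
  have -> : A * (21 ^+ 3 * B) * (#|I|%:R * #|J|%:R) = 21 ^+ 3 * X by rewrite /X; ring.
  rewrite /overlap_const [Num.sqrt (_ * X)]sqrtrM ?exprn_ge0// [Num.sqrt (_ * 81)]sqrtrM ?exprn_ge0//.
  have -> : 81 = 9 ^+ 2 :> R by ring.
  by rewrite sqrtr_sqr ger0_norm ?ler0n// mulrA [9 * _]mulrC.
apply: ler_wpM2l.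
  apply: (mulr_ge0 _ Z0); apply: mulr_ge0; last by rewrite invr_ge0 ltW.
  by apply: (mulr_ge0 _ (sqr_ge0 _)); apply: (mulr_ge0 _ sc0); exact: ler0n.
have -> : A * (21 ^+ 3 * B) * (#|I'|%:R * #|J|%:R) = (21 ^+ 3 * 81) * X.
  by rewrite !card_prod !card_ord !natrM /X; ring.
by rewrite sqrtrM// mulr_ge0// exprn_ge0.
Qed.
End Localisation.

(** * Choosing the stopping scale *)

Lemma expn_bracket (R : realType) (q g : R) : 2 <= q -> 1 <= g ->
  exists K : nat, q ^+ K <= g < q ^+ K.+1.
Proof.
move=> q2 g1.
have q0 : 0 <= q by apply: le_trans q2.
have ex : exists n, g < q ^+ n.
  exists (Num.truncn g).+1; apply: lt_le_trans (truncnS_gt g) _.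
  apply: (@le_trans _ _ (2 ^+ (Num.truncn g).+1)); last by apply: lerXn2r; rewrite ?nnegrE.
  by rewrite -natrX ler_nat ltnW// ltn_expl.
case: (ex_minnP ex) => -[|K] hK hmin; first by move: hK; rewrite expr0 ltNge g1.
exists K; rewrite hK andbT leNgt; apply/negP => h.
by have := hmin _ h; rewrite ltnn.
Qed.

Section Optimise.
Variables (R : realType) (N p X delta sg : R).

(** The geometry enters the rest only through five numbers: N is the number of incidences, p the
    product of the cardinalities, X the product of p with the spacing bounds, and sg = (alpha +
    beta) / 2. Choosing the number of steps is then a one-variable optimisation. *)
Definition multiscale_bound : Prop := forall (D K : nat) (eps Z q : R),
  (0 < D)%N -> 0 < eps -> q = 300 * D%:R -> 300 <= q `^ eps ->
  (forall k, (k < K)%N -> 12 * delta * q ^+ k <= 1) ->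
  (forall k, (k < K)%N -> (q ^+ k) `^ (sg - 2) <= Z) -> 0 <= Z ->
  N <= delta `^ (- eps) * (q `^ eps * (q ^+ K)^-1 *
     Num.min (81 * p) (overlap_const R * Num.sqrt X * delta `^ (- sg))
    + 1728 * step_const R D * (3 - ln delta) ^+ 2 * delta^-1 * Z * (overlap_const R * Num.sqrt X)).

(** Inside the parentheses, the first summand serves when scale 1 is reached and the second when the
    iteration stops earlier; the final 1 lets the constant absorb the trivial bound N <= p. *)
Definition low_const (D : nat) (eps : R) : R :=
  (300 * D%:R) `^ eps * (12 * overlap_const R + 81 * (300 * D%:R)) + 1.
Definition high_const (D : nat) (eps : R) : R :=
  1728 * step_const R D * (3 + eps^-1) ^+ 2 * overlap_const R.

Hypotheses (H : multiscale_bound) (d0 : 0 < delta) (d1 : delta < 1)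
  (X0 : 0 <= X) (p0 : 0 <= p).
Variables (D : nat) (eps : R).
Hypotheses (D0 : (0 < D)%N) (e0 : 0 < eps) (De : 300 <= (300 * D%:R) `^ eps).

Let L := low_const D eps.
Let C := high_const D eps.

Let oc0 : 0 <= overlap_const R. Proof. exact: sqrtr_ge0. Qed.
Let di0 : 0 < delta^-1. Proof. by rewrite invr_gt0. Qed.
Let q300 : 300 <= 300 * D%:R :> R.
Proof. by rewrite -natrM ler_nat leq_pmulr. Qed.
Let q0 : 0 < 300 * D%:R :> R.
Proof. by apply: lt_le_trans q300; rewrite ltr0n. Qed.
Let sc0 : 0 <= step_const R D.
Proof. by apply: mulr_ge0; [exact: ler0n | exact: sqrtr_ge0]. Qed.
Let C0 : 0 <= C.
Proof.
apply: (mulr_ge0 _ oc0); apply: (mulr_ge0 _ (sqr_ge0 _)).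
by apply: (mulr_ge0 _ sc0); exact: ler0n.
Qed.
Let Lparts : [/\ (300 * D%:R) `^ eps * (12 * overlap_const R) <= L,
   (300 * D%:R) `^ eps * (81 * (300 * D%:R)) <= L & 1 <= L].
Proof.
have h1 : 0 <= 12 * overlap_const R by apply: mulr_ge0 => //; exact: ler0n.
have h2 : 0 <= 81 * (300 * D%:R) :> R.
  by apply: mulr_ge0; [exact: ler0n | exact: ltW].
have h3 : 0 <= (300 * D%:R) `^ eps :> R by exact: powR_ge0.
have u1 := mulr_ge0 h3 h1; have u2 := mulr_ge0 h3 h2.
rewrite /L /low_const mulrDr.
move: (_ * (12 * _)) (_ * (81 * _)) u1 u2 => a b a0 b0.
by split; [rewrite -addrA lerDl addr_ge0 | rewrite addrAC lerDr addr_ge0 | rewrite lerDr addr_ge0].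
Qed.

Let loss : delta `^ (- eps) <= delta `^ (- (3 * eps)).
Proof.
apply: ger_powR; first by rewrite d0 ltW.
by rewrite lerN2 ler_peMl ?(ltW e0)// ler1n.
Qed.

(** Each of the two logarithms costs delta^-eps, in addition to the delta^-eps of the iteration;
    hence the exponent 3 eps from here on. *)
Let logloss : delta `^ (- eps) * (3 - ln delta) ^+ 2 <=
  (3 + eps^-1) ^+ 2 * delta `^ (- (3 * eps)).
Proof.
have h := log_le_powR e0 d0 d1.
have l0 : 0 <= 3 - ln delta.
  by rewrite subr_ge0 (le_trans (ln_le0 (ltW d1)))// ler0n.
have -> : delta `^ (- (3 * eps)) = delta `^ (- eps) * (delta `^ (- eps)) ^+ 2.
  rewrite -powR_mulrn ?powR_ge0// -powRrM -powRD ?(gt_eqF d0) ?implybT//.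
  by congr (_ `^ _); ring.
rewrite [leRHS]mulrCA; apply: ler_wpM2l; first exact: powR_ge0.
rewrite -exprMn; apply: lerXn2r; rewrite ?nnegrE// mulr_ge0 ?powR_ge0//.
by rewrite addr_ge0 ?ler0n// invr_ge0 ltW.
Qed.

Let assemble (low high : R) : 0 <= low -> 0 <= high ->
  delta `^ (- eps) * (low + 1728 * step_const R D * (3 - ln delta) ^+ 2 * delta^-1 * high * (overlap_const R * Num.sqrt X))
  <= delta `^ (- (3 * eps)) * (low + C * (delta^-1 * high * Num.sqrt X)).
Proof.
move=> l0 h0; rewrite !mulrDr; apply: lerD; first by rewrite ler_wpM2r.
have p17 : 0 <= 1728 * step_const R D by apply: (mulr_ge0 _ sc0); exact: ler0n.
set u := 1728 * step_const R D in p17 *.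
have -> : delta `^ (- eps) * (u * (3 - ln delta) ^+ 2 / delta * high * (overlap_const R * Num.sqrt X)) =
  (delta `^ (- eps) * (3 - ln delta) ^+ 2) * (u * delta^-1 * high * (overlap_const R * Num.sqrt X)) by ring.
have -> : delta `^ (- (3 * eps)) * (C * (delta^-1 * high * Num.sqrt X)) =
  ((3 + eps^-1) ^+ 2 * delta `^ (- (3 * eps))) * (u * delta^-1 * high * (overlap_const R * Num.sqrt X)).
  by rewrite /C /high_const -/u; ring.
apply: ler_wpM2r => //.
have i0 := ltW di0; have s0 := sqrtr_ge0 X.
by do 3!apply: mulr_ge0 => //; apply: mulr_ge0.
Qed.

(** The iteration runs until 12 delta q^K >= 1. Then q^-K <= 12 delta, and the local bound turns the
    low part into delta^(1 - sg), written as delta^-1 delta^(2 - sg) for comparison with the high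
    part. *)
Lemma full_scale_bound (Z : R) :
  (forall x, 1 <= x -> x <= delta^-1 -> x `^ (sg - 2) <= Z) ->
  N <= delta `^ (- (3 * eps)) *
    (L * (delta^-1 * delta `^ (2 - sg) * Num.sqrt X) + C * (delta^-1 * Z * Num.sqrt X)).
Proof.
move=> hZ.
have Z0 : 0 <= Z.
  by apply: le_trans (hZ 1 (lexx _) _); rewrite ?powR_ge0// invf_ge1// ltW.
have q300' := q300; set q : R := 300 * D%:R in q300' *.
have q1 k : 1 <= q ^+ k by apply: exprn_ege1; apply: le_trans q300'; rewrite ler1n.
have p12 : 0 < 12 * delta by apply: mulr_gt0 => //; rewrite ltr0n.
have [K hK1 hK2] : exists2 K : nat, (forall k, (k < K)%N -> 12 * delta * q ^+ k <= 1)
    & 1 <= 12 * delta * q ^+ K.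
  have [h|h] := leP 1 (12 * delta); first by exists 0%N => //; rewrite expr0 mulr1.
  have q2 : 2 <= q by apply: le_trans q300'; rewrite ler_nat.
  have g1 : 1 <= (12 * delta)^-1 by rewrite invf_ge1// ltW.
  have [K /andP[h1 h2]] := expn_bracket q2 g1.
  exists K.+1.
    move=> k kK; rewrite -ler_pdivlMl// mulr1; apply: le_trans h1.
    by apply: ler_weXn2l => //; have := q1 1%N; rewrite expr1.
  by rewrite -ler_pdivrMl// mulr1 ltW.
have hZ' k : (k < K)%N -> (q ^+ k) `^ (sg - 2) <= Z.
  move=> kK; apply: hZ => //; rewrite -[delta^-1]mul1r ler_pdivlMr//.
  apply: le_trans (hK1 k kK); rewrite [q ^+ k * _]mulrC; apply: ler_wpM2r.
    by apply: le_trans (q1 k).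
  by rewrite ler_peMl ?(ltW d0)// ler1n.
apply: le_trans (H D0 e0 (erefl q) De hK1 hZ' Z0) _.
have m0 : 0 <= Num.min (81 * p) (overlap_const R * Num.sqrt X * delta `^ (- sg)).
  by rewrite le_min mulr_ge0 ?ler0n// mulr_ge0 ?powR_ge0// mulr_ge0// sqrtr_ge0.
have qK0 : 0 <= (q ^+ K)^-1 by rewrite invr_ge0 (le_trans _ (q1 K)).
have qe0 : 0 <= q `^ eps by exact: powR_ge0.
apply: le_trans (assemble _ Z0) _; first by rewrite mulr_ge0// mulr_ge0.
apply: ler_wpM2l; first exact: powR_ge0.
rewrite lerD2r.
have [Lp _ _] := Lparts.
apply: (@le_trans _ _ (q `^ eps * (12 * overlap_const R) * (delta^-1 * delta `^ (2 - sg) * Num.sqrt X))); last first.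
  by apply: ler_wpM2r Lp; rewrite mulr_ge0 ?sqrtr_ge0// mulr_ge0 ?powR_ge0// ltW.
have -> : delta^-1 * delta `^ (2 - sg) = delta * delta `^ (- sg).
  rewrite -powR_inv1 ?(ltW d0)// -{3}[delta]powRr1 ?(ltW d0)// -!powRD ?(gt_eqF d0) ?implybT//.
  by congr (_ `^ _); ring.
apply: (@le_trans _ _ (q `^ eps * (12 * delta) * (overlap_const R * Num.sqrt X * delta `^ (- sg)))); last first.
  by rewrite le_eqVlt; apply/orP; left; apply/eqP; ring.
apply: ler_pM => //; first by rewrite mulr_ge0.
  by apply: ler_wpM2l => //; rewrite -[_^-1]mul1r ler_pdivrMr// (lt_le_trans ltr01).
by rewrite ge_min lexx orbT.
Qed.

(** K is the last exponent with q^K <= g, so q^-K < q / g, and the low part is bounded by all pairs.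
    As sg >= 2, the high parts increase with the scale and are bounded by their value at g. *)
Lemma stopped_bound (g : R) : 1 <= g -> g <= delta^-1 -> 0 <= sg - 2 ->
  N <= delta `^ (- (3 * eps)) *
    (L * (g^-1 * p) + C * (delta^-1 * g `^ (sg - 2) * Num.sqrt X)).
Proof.
move=> g1 gd s0; have g0 : 0 < g by apply: lt_le_trans g1.
have q300' := q300; set q : R := 300 * D%:R in q300' *.
have q1 k : 1 <= q ^+ k by apply: exprn_ege1; apply: le_trans q300'; rewrite ler1n.
have q2 : 2 <= q by apply: le_trans q300'; rewrite ler_nat.
have q1' : 1 <= q by have := q1 1%N; rewrite expr1.
have [K /andP[h1 h2]] := expn_bracket q2 g1.
have qK k : (k < K)%N -> q * q ^+ k <= g.
  by move=> kK; apply: le_trans h1; rewrite -exprS; apply: ler_weXn2l.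
have hK k : (k < K)%N -> 12 * delta * q ^+ k <= 1.
  move=> kK; rewrite mulrAC -ler_pdivlMr// mul1r; apply: le_trans gd.
  apply: le_trans (qK k kK); apply: ler_wpM2r; first by apply: le_trans (q1 k).
  by apply: le_trans q300'; rewrite ler_nat.
have hZ k : (k < K)%N -> (q ^+ k) `^ (sg - 2) <= g `^ (sg - 2).
  move=> kK; have qk0 : 0 <= q ^+ k by apply: le_trans (q1 k).
  apply: ge0_ler_powR; rewrite ?nnegrE ?(ltW g0)//.
  by apply: le_trans (qK k kK); rewrite ler_peMl.
apply: le_trans (H D0 e0 (erefl q) De hK hZ (powR_ge0 _ _)) _.
have m0 : 0 <= Num.min (81 * p) (overlap_const R * Num.sqrt X * delta `^ (- sg)).
  by rewrite le_min mulr_ge0 ?ler0n// mulr_ge0 ?powR_ge0// mulr_ge0// sqrtr_ge0.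
have qKp : 0 < q ^+ K by apply: lt_le_trans (q1 K).
have qK0 : 0 <= (q ^+ K)^-1 by rewrite invr_ge0 ltW.
have qe0 : 0 <= q `^ eps by exact: powR_ge0.
apply: le_trans (assemble _ (powR_ge0 _ _)) _; first by rewrite mulr_ge0// mulr_ge0.
apply: ler_wpM2l; first exact: powR_ge0.
rewrite lerD2r.
have [_ Lp _] := Lparts.
apply: (@le_trans _ _ (q `^ eps * (81 * q) * (g^-1 * p))); last first.
  by apply: ler_wpM2r Lp; rewrite mulr_ge0// invr_ge0 ltW.
apply: (@le_trans _ _ (q `^ eps * (q * g^-1) * (81 * p))); last first.
  by rewrite le_eqVlt; apply/orP; left; apply/eqP; ring.
apply: ler_pM => //; first by rewrite mulr_ge0.
  apply: ler_wpM2l => //; rewrite -[_^-1]mul1r ler_pdivrMr// mulrAC ler_pdivlMr// mul1r -exprS.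
  exact: ltW.
by rewrite ge_min lexx.
Qed.

(** When sg <= 2, the powers of the scale in the high part and delta^(2 - sg) in the low part are
    all at most 1. *)
Lemma sparse_bound : sg <= 2 ->
  N <= (L + C) * delta `^ (- (3 * eps)) * delta^-1 * Num.sqrt X.
Proof.
move=> s2.
have h x : 1 <= x -> x <= delta^-1 -> x `^ (sg - 2) <= 1.
  by move=> x1 _; rewrite -[leRHS](powRr0 x); apply: ler_powR => //; rewrite subr_le0.
apply: le_trans (full_scale_bound h) _.
have L0 : 0 <= L by have [_ _ L1] := Lparts; apply: le_trans L1; exact: ler01.
have e : delta `^ (2 - sg) <= 1.
  by rewrite -[leRHS](powRr0 delta); apply: ger_powR; rewrite ?d0 ?(ltW d1)// subr_ge0.
have s0 := sqrtr_ge0 X; have i0 := ltW di0.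
apply: (@le_trans _ _ (delta `^ (- (3 * eps)) *
    (L * (delta^-1 * 1 * Num.sqrt X) + C * (delta^-1 * 1 * Num.sqrt X)))).
  apply: ler_wpM2l; first exact: powR_ge0.
  rewrite lerD2r; apply: ler_wpM2l => //; apply: ler_wpM2r => //.
  exact: ler_wpM2l.
by rewrite le_eqVlt; apply/orP; left; apply/eqP; ring.
Qed.

(* [g] is the ratio of scales at which the two terms of [stopped_bound] balance. *)
Lemma dense_bound (lam : R) : lam = 1 / (2 * sg - 2) ->
  2 < sg -> 0 < p -> 0 < X -> N <= p ->
  N <= (L + C) * delta `^ (- (3 * eps)) * (delta `^ (- 2 * lam) * X `^ lam * p `^ (1 - 2 * lam)).
Proof.
move=> lamD s2 pp Xp Np.
have s1 : 0 < sg - 1 by lra.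
have lamE : 2 * lam = (sg - 1)^-1 by rewrite lamD; field; lra.
have l0 : 0 < 2 * lam by rewrite lamE invr_gt0.
have sX : 0 < Num.sqrt X by rewrite sqrtr_gt0.
pose G := p * delta / Num.sqrt X.
have G0 : 0 < G by rewrite divr_gt0// mulr_gt0.
pose g := G `^ (2 * lam).
have g0 : 0 < g by rewrite powR_gt0.
have gG : g `^ (sg - 1) = G.
  by rewrite /g -powRrM lamE mulVf ?gt_eqF// powRr1// ltW.
(* The target is the low term of [stopped_bound] at g, up to its constant; the exponent 2 lam = 1 /
   (sg - 1) solves g^(sg - 1) = G. *)
have T : delta `^ (- 2 * lam) * X `^ lam * p `^ (1 - 2 * lam) = p / g.
  have sXl : X `^ lam = Num.sqrt X `^ (2 * lam).
    by rewrite -powR12_sqrt// -powRrM; congr (_ `^ _); rewrite mulrA mulVf ?mul1r// gt_eqF.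
  rewrite /g /G !powRM ?(ltW pp) ?(ltW d0) ?mulr_ge0 ?invr_ge0 ?(ltW d0) ?(ltW pp) ?(ltW sX)//.
  rewrite sXl powRB ?(gt_eqF pp) ?implybT// powRr1 ?(ltW pp)// mulNr powRN.
  rewrite -[(Num.sqrt X)^-1]powR_inv1 ?(ltW sX)// [(_ `^ (-1)) `^ _]powRAC powR_inv1 ?powR_ge0//.
  have h1 : delta `^ (2 * lam) != 0 by rewrite gt_eqF// powR_gt0.
  have h2 : p `^ (2 * lam) != 0 by rewrite gt_eqF// powR_gt0.
  have h3 : Num.sqrt X `^ (2 * lam) != 0 by rewrite gt_eqF// powR_gt0.
  by field; rewrite h1 h2 h3.
rewrite T.
have [_ _ L1] := Lparts.
have L0 : 0 <= L by apply: le_trans L1; exact: ler01.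
have pg0 : 0 <= p / g by rewrite divr_ge0 ?ltW.
have dp0 : 0 <= delta `^ (- (3 * eps)) by exact: powR_ge0.
have dp1 : 1 <= delta `^ (- (3 * eps)).
  rewrite -[leLHS](powRr0 delta); apply: ger_powR; rewrite ?d0 ?(ltW d1)//.
  by rewrite oppr_le0 mulr_ge0 ?ler0n// ltW.
(* The balancing ratio may leave [1, delta^-1]: below 1 the trivial bound N <= p is enough, and
   above delta^-1 the iteration runs up to scale 1 instead. *)
have [glt|g1] := ltP g 1.
  apply: le_trans Np _; apply: (@le_trans _ _ (p / g)).
    by rewrite ler_pdivlMr// ler_piMr ?ltW.
  rewrite -[leLHS]mul1r; apply: ler_wpM2r => //.
  by rewrite -[leLHS]mul1r; apply: ler_pM => //; rewrite (le_trans L1)// lerDl.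
have high : delta^-1 * g `^ (sg - 2) * Num.sqrt X = p / g.
  have -> : g `^ (sg - 2) = G / g.
    have -> : sg - 2 = (sg - 1) - 1 by ring.
    by rewrite powRB ?(gt_eqF g0) ?implybT// gG powRr1 ?ltW.
  have h1 : delta != 0 by rewrite gt_eqF.
  have h2 : Num.sqrt X != 0 by rewrite gt_eqF.
  have h3 : g != 0 by rewrite gt_eqF.
  by rewrite /G; field; rewrite h1 h2 h3.
have [gd|gd] := leP g delta^-1.
  apply: le_trans (stopped_bound g1 gd _) _; first by lra.
  by rewrite high le_eqVlt; apply/orP; left; apply/eqP; ring.
have h x : 1 <= x -> x <= delta^-1 -> x `^ (sg - 2) <= g `^ (sg - 2).
  move=> x1 xd; apply: ge0_ler_powR; rewrite ?nnegrE ?(ltW g0) ?(le_trans _ x1)//; first by lra.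
  by apply: le_trans xd (ltW gd).
apply: le_trans (full_scale_bound h) _.
have e : delta `^ (2 - sg) <= g `^ (sg - 2).
  have -> : delta `^ (2 - sg) = (delta^-1) `^ (sg - 2).
    by rewrite -[delta^-1]powR_inv1 ?(ltW d0)// -powRrM; congr (_ `^ _); ring.
  by apply: h => //; apply: ltW; rewrite invf_gt1.
rewrite [leRHS](_ : _ = delta `^ (- (3 * eps)) * (L * (p / g) + C * (p / g))); last by ring.
rewrite -high; apply: ler_wpM2l => //; rewrite lerD2r; apply: ler_wpM2l => //.
by rewrite ler_wpM2r ?(ltW sX)// ler_wpM2l ?(ltW di0).
Qed.

Lemma bound_consts_ge0 : 0 <= L + C.
Proof. by have [_ _ L1] := Lparts; rewrite addr_ge0// (le_trans ler01 L1). Qed.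
End Optimise.

Local Open Scope classical_set_scope.
Local Open Scope ring_scope.

(** * Circles, discs and their neighbourhoods *)

Section EuclideanNorm.
Variables (R : realType) (n : nat).
Implicit Types u v : 'rV[R]_n.

Lemma enorm_ge0 u : 0 <= enorm u. Proof. exact: sqrtr_ge0. Qed.

Lemma enorm_sqr u : enorm u ^+ 2 = \sum_i u 0 i ^+ 2.
Proof. by rewrite sqr_sqrtr// sumr_ge0// => i _; exact: sqr_ge0. Qed.

Lemma enormN u : enorm (- u) = enorm u.
Proof. by congr Num.sqrt; apply: eq_bigr => i _; rewrite mxE sqrrN. Qed.

Lemma enorm_coord_le u i : `|u 0 i| <= enorm u.
Proof.
rewrite -sqrtr_sqr ler_sqrt; last by apply: sumr_ge0 => j _; exact: sqr_ge0.
by rewrite (bigD1 i)//= lerDl sumr_ge0// => j _; exact: sqr_ge0.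
Qed.

Lemma enorm_delta (a : R) (i : 'I_n) : enorm (a *: delta_mx 0 i : 'rV[R]_n) = `|a|.
Proof.
rewrite -sqrtr_sqr; congr Num.sqrt; rewrite (bigD1 i)//= big1 ?addr0.
  by rewrite !mxE !eqxx mulr1.
by move=> j /negbTE ji; rewrite !mxE ji andbF mulr0 expr0n.
Qed.

Lemma cauchy_schwarz (I : finType) (f g : I -> R) :
  (\sum_i f i * g i) ^+ 2 <= (\sum_i f i ^+ 2) * (\sum_i g i ^+ 2).
Proof.
rewrite -subr_ge0 -(@pmulr_rge0 _ 2)//.
suff -> : 2 * ((\sum_i f i ^+ 2) * (\sum_i g i ^+ 2) - (\sum_i f i * g i) ^+ 2) =
    \sum_i \sum_j (f i * g j - f j * g i) ^+ 2.
  by apply: sumr_ge0 => i _; apply: sumr_ge0 => j _; exact: sqr_ge0.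
set F := \sum_i f i ^+ 2; set G := \sum_i g i ^+ 2; set H := \sum_i f i * g i.
have inner i : \sum_j (f i * g j - f j * g i) ^+ 2 =
    G * f i ^+ 2 + F * g i ^+ 2 - 2 * H * (f i * g i).
  rewrite (eq_bigr (fun j => f i ^+ 2 * g j ^+ 2 + g i ^+ 2 * f j ^+ 2
     + (- 2 * (f i * g i)) * (f j * g j))); last by move=> j _; ring.
  by rewrite !big_split /= -!mulr_sumr -/F -/G -/H; ring.
rewrite (eq_bigr _ (fun i _ => inner i)) sumrB big_split /= -!mulr_sumr -/F -/G -/H.
by ring.
Qed.

Lemma enormD u v : enorm (u + v) <= enorm u + enorm v.
Proof.
have cs : \sum_i u 0 i * v 0 i <= enorm u * enorm v.
  apply: le_trans (ler_norm _) _.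
  rewrite -(@ler_pXn2r _ 2)// ?nnegrE ?mulr_ge0 ?enorm_ge0// exprMn !enorm_sqr.
  by rewrite real_normK ?num_real// cauchy_schwarz.
rewrite -(@ler_pXn2r _ 2)// ?nnegrE ?addr_ge0 ?enorm_ge0// sqrrD !enorm_sqr.
rewrite (eq_bigr (fun i => u 0 i ^+ 2 + v 0 i ^+ 2 + 2 * (u 0 i * v 0 i))); last first.
  by move=> i _; rewrite mxE; ring.
by rewrite !big_split /= -mulr_sumr; lra.
Qed.

Lemma limit_le0 (d delta : R) : 0 < delta ->
  (forall s, 0 <= s -> s < delta -> d + s < delta) -> d <= 0.
Proof.
move=> d0 h; rewrite leNgt; apply/negP => dp.
have [hd|hd] := leP d delta.
  by have := h (delta - d); rewrite subrKC ltxx => H; suff : false by []; apply: H; lra.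
by have := h 0 (lexx _) d0; rewrite addr0 ltNge ltW.
Qed.

(** The extents of the balls are compared in both directions of each axis. Families being sets of
    subsets, this is what allows counting balls by their centres. *)
Lemma eball_center (x x' : 'rV[R]_n) (delta : R) :
  0 < delta -> eball x delta `<=` eball x' delta -> x = x'.
Proof.
move=> d0 h.
have key (sgn : R) i : sgn = 1 \/ sgn = -1 -> sgn * (x 0 i - x' 0 i) <= 0.
  move=> hs; have n1 : `|sgn| = 1 by case: hs => ->; rewrite ?normrN normr1.
  apply: (limit_le0 d0) => s s0 sd.
  have : eball x' delta (x + (sgn * s) *: delta_mx 0 i).
    by apply: h; rewrite /eball /= addrC addKr enorm_delta normrM n1 mul1r ger0_norm.
  rewrite /eball /= => /(le_lt_trans (enorm_coord_le _ i)).
  rewrite !mxE !eqxx mulr1; apply: le_lt_trans.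
  rewrite -[leRHS]mul1r -n1 -normrM; apply: le_trans (ler_norm _).
  have s1 : sgn * sgn = 1 by case: hs => ->; rewrite ?mulrNN mul1r.
  rewrite le_eqVlt; apply/orP; left; apply/eqP.
  have -> : sgn * (x 0 i + sgn * s - x' 0 i) = sgn * (x 0 i - x' 0 i) + (sgn * sgn) * s by ring.
  by rewrite s1 mul1r.
apply/rowP => i; apply/eqP; rewrite -subr_eq0 eq_le.
have := key 1 i (or_introl erefl); rewrite mul1r => ->.
by have := key (-1) i (or_intror erefl); rewrite mulN1r oppr_le0 => ->.
Qed.
End EuclideanNorm.

Section CircleNeighbourhoods.
Variable R : realType.

(** Only points near the outer boundary are compared, in the two directions of an axis, so the
    argument also covers neighbourhoods without a hole, which occur for radii below delta. The bound
    forces r <= r', so that two opposite inclusions equate the radii and then the centres. *)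
Lemma nbhd_circle_sub (x x' : 'rV[R]_2) (r r' delta : R) (i : 'I_2) :
  0 < delta -> 0 <= r ->
  nbhd_of delta (circle x r) `<=` nbhd_of delta (circle x' r') ->
  `|x 0 i - x' 0 i| <= r' - r.
Proof.
move=> d0 r0 h.
have key (sgn : R) : sgn = 1 \/ sgn = -1 -> sgn * (x 0 i - x' 0 i) + r - r' <= 0.
  move=> hs; have n1 : `|sgn| = 1 by case: hs => ->; rewrite ?normrN normr1.
  apply: (limit_le0 d0) => s s0 sd.
  have : nbhd_of delta (circle x' r') (x + (sgn * (r + s)) *: delta_mx 0 i).
    apply: h; exists (x + (sgn * r) *: delta_mx 0 i).
      by rewrite /circle /= addrC addKr enorm_delta normrM n1 mul1r ger0_norm.
    have -> : x + (sgn * (r + s)) *: delta_mx 0 i - (x + (sgn * r) *: delta_mx 0 i)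
      = (sgn * s) *: delta_mx 0 i :> 'rV[R]_2.
      by apply/rowP => k; rewrite !mxE; ring.
    by rewrite enorm_delta normrM n1 mul1r ger0_norm.
  case=> w hw hd; set y := x + _ in hd.
  have : enorm (y - x') < r' + delta.
    have -> : y - x' = (y - w) + (w - x') by rewrite addrA subrK.
    by apply: le_lt_trans (enormD _ _) _; rewrite hw addrC ltrD2l.
  move/(le_lt_trans (enorm_coord_le _ i)).
  rewrite !mxE !eqxx mulr1 => hc.
  suff : sgn * (x 0 i - x' 0 i) + r + s < r' + delta by lra.
  apply: le_lt_trans hc; rewrite -[leRHS]mul1r -n1 -normrM; apply: le_trans (ler_norm _).
  have s1 : sgn * sgn = 1 by case: hs => ->; rewrite ?mulrNN mul1r.
  rewrite le_eqVlt; apply/orP; left; apply/eqP.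
  have -> : sgn * (x 0 i + sgn * (r + s) - x' 0 i) =
     sgn * (x 0 i - x' 0 i) + (sgn * sgn) * (r + s) by ring.
  by rewrite s1 mul1r addrA.
have k1 := key 1 (or_introl erefl); have k2 := key (-1) (or_intror erefl).
by rewrite ler_norml; apply/andP; split; lra.
Qed.

Lemma nbhd_circle_inj (x x' : 'rV[R]_2) (r r' delta : R) :
  0 < delta -> 0 <= r -> 0 <= r' ->
  nbhd_of delta (circle x r) = nbhd_of delta (circle x' r') -> x = x' /\ r = r'.
Proof.
move=> d0 r0 r0' e.
have h i := @nbhd_circle_sub x x' r r' delta i d0 r0 ltac:(by rewrite e).
have h' i := @nbhd_circle_sub x' x r' r delta i d0 r0' ltac:(by rewrite e).
have rr : r = r'.
  have a := le_trans (normr_ge0 _) (h 0); have b := le_trans (normr_ge0 _) (h' 0).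
  by apply/eqP; rewrite eq_le; apply/andP; split; lra.
split => //; apply/rowP => i.
by have := h i; rewrite rr subrr normr_le0 subr_eq0 => /eqP.
Qed.

(** By the triangle inequality |x - y| and r differ by less than 2 delta, while |x - y| + r <= 4 +
    2; hence 12 = 2 * 6. *)
Lemma nbhd_circle_meets_eball (x y : 'rV[R]_2) (r delta : R) :
  0 < delta -> delta < 1 -> 0 <= r -> r <= 2 ->
  nbhd_of delta (circle x r) `&` eball y delta !=set0 ->
  [/\ `|(x 0 0 - y 0 0) ^+ 2 + (x 0 1 - y 0 1) ^+ 2 - r ^+ 2| <= 12 * delta,
      `|x 0 0 - y 0 0| <= 4 & `|x 0 1 - y 0 1| <= 4].
Proof.
move=> d0 d1 r0 r2 [w [[z hz wz] wy]].
rewrite /circle /= in hz; rewrite /eball /= in wy.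
set u := enorm (x - y).
have u0 : 0 <= u by exact: enorm_ge0.
have uE : u ^+ 2 = (x 0 0 - y 0 0) ^+ 2 + (x 0 1 - y 0 1) ^+ 2.
  rewrite enorm_sqr big_ord_recl big_ord1 !mxE.
  by have -> : lift ord0 ord0 = 1 :> 'I_2 by apply/val_inj.
have zx : enorm (x - z) = r by rewrite -opprB enormN.
have ur : u < r + 2 * delta.
  have -> : u = enorm ((x - z) + (- (w - z) + (w - y))).
    by congr enorm; apply/rowP => k; rewrite !mxE; ring.
  apply: le_lt_trans (enormD _ _) _; rewrite zx ltrD2l.
  by apply: le_lt_trans (enormD _ _) _; rewrite enormN mulrDl mul1r ltrD.
have ru : r < u + 2 * delta.
  have -> : r = enorm ((x - y) + (- (w - y) + (w - z))).
    by rewrite -zx; congr enorm; apply/rowP => k; rewrite !mxE; ring.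
  apply: le_lt_trans (enormD _ _) _; rewrite ltrD2l.
  by apply: le_lt_trans (enormD _ _) _; rewrite enormN mulrDl mul1r ltrD.
have u4 : u <= 4 by lra.
split.
- rewrite -uE subr_sqr normrM.
  have -> : 12 * delta = (2 * delta) * 6 by ring.
  by apply: ler_pM => //; rewrite ler_norml; apply/andP; split; lra.
- by apply: le_trans u4; have := enorm_coord_le (x - y) 0; rewrite !mxE.
- by apply: le_trans u4; have := enorm_coord_le (x - y) 1; rewrite !mxE.
Qed.
End CircleNeighbourhoods.

(** * From families of sets to indexed families of centres and radii *)

Lemma card_le_realcard (R : realType) (T : choiceType) (I : finType) (Q : {set I})
    (f : I -> T) (W : set T) :
  finite_set W -> {in Q &, injective f} -> (forall i, i \in Q -> W (f i)) ->
  #|Q|%:R <= realcard R W.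
Proof.
move=> fW inj hW; rewrite /realcard ler_nat cardE -(size_map f).
apply: uniq_leq_size.
  rewrite map_inj_in_uniq ?enum_uniq// => i j; rewrite !mem_enum; exact: inj.
move=> w /mapP[i]; rewrite mem_enum => /hW h ->.
by rewrite in_fset_set// inE.
Qed.

Lemma realcard_le_card (R : realType) (T : choiceType) (I : finType) (Q : {set I})
    (f : I -> T) (W : set T) :
  finite_set W -> (forall w, W w -> exists2 i, i \in Q & w = f i) ->
  realcard R W <= #|Q|%:R.
Proof.
move=> fW hW; rewrite /realcard ler_nat cardE -(size_map f).
apply: uniq_leq_size; first exact: fset_uniq.
move=> w; rewrite in_fset_set// inE => /hW[i iQ ->].
by rewrite map_f// mem_enum.
Qed.

Section Families.
Variables (R : realType) (alpha beta delta : R) (P TT : set (set 'rV[R]_2)).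
Hypotheses (beta0 : 0 <= beta) (beta3 : beta <= 3) (alpha0 : 0 <= alpha) (alpha2 : alpha <= 2).
Hypotheses (d0 : 0 < delta) (d1 : delta < 1).
Hypotheses (finP : finite_set P) (famP : circle_nbhd_family delta P).
Hypotheses (finT : finite_set TT) (famT : ball_family delta TT).

Let I : finType := fset_set P.
Let J : finType := fset_set TT.

Let valIP (i : I) : P (val i).
Proof. by have := valP i; rewrite in_fset_set// inE. Qed.
Let valJP (j : J) : TT (val j).
Proof. by have := valP j; rewrite in_fset_set// inE. Qed.

Let cardI : realcard R P = #|I|%:R.
Proof. by rewrite /realcard cardfE. Qed.
Let cardJ : realcard R TT = #|J|%:R.
Proof. by rewrite /realcard cardfE. Qed.

Let exI : {f : I -> 'rV[R]_2 * R | forall i,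
  [/\ 1 <= (f i).2, (f i).2 <= 2 & val i = nbhd_of delta (circle (f i).1 (f i).2)]}.
Proof.
apply: cid; have h (i : I) : exists xr : 'rV[R]_2 * R,
  [/\ 1 <= xr.2, xr.2 <= 2 & val i = nbhd_of delta (circle xr.1 xr.2)].
  by have [x [r ?]] := famP (valIP i); exists (x, r).
by have [f hf] := choice h; exists f.
Qed.
Let exJ : {y : J -> 'rV[R]_2 | forall j, val j = eball (y j) delta}.
Proof.
apply: cid; have h (j : J) : exists y : 'rV[R]_2, val j = eball y delta.
  by have [y ?] := famT (valJP j); exists y.
by have [f hf] := choice h; exists f.
Qed.

Let cx i := (sval exI i).1.
Let rad i := (sval exI i).2.
Let cy := sval exJ.

Let radP i : 1 <= rad i <= 2.
Proof. by have [h1 h2 _] := svalP exI i; rewrite h1 h2. Qed.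
Let valIE i : val i = nbhd_of delta (circle (cx i) (rad i)).
Proof. by have [_ _ h] := svalP exI i. Qed.
Let valJE j : val j = eball (cy j) delta.
Proof. exact: (svalP exJ j). Qed.
Let rad0 i : 0 < rad i.
Proof. by have /andP[h _] := radP i; apply: lt_le_trans h. Qed.

Let self_ball n (x : 'rV[R]_n) : eball x delta x.
Proof.
rewrite /eball /= subrr; rewrite (_ : enorm _ = 0)//.
by rewrite /enorm big1 ?sqrtr0// => i _; rewrite mxE expr0n.
Qed.

Let K := spacing_const alpha TT delta.
Let Kc := circle_spacing_const beta P delta.

Let PhiE (i : I) : Phi delta P (eball (row_mx (cx i) (rad i)%:M) delta).
Proof. by exists (cx i), (rad i); rewrite -valIE; split. Qed.

(** A neighbourhood determines its circle, so each member of [P] contributes the single ball given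
    by its chosen centre and radius. *)
Let finPhi : finite_set (Phi delta P).
Proof.
apply: (@sub_finite_set _ _ ((fun i : I => eball (row_mx (cx i) (rad i)%:M) delta) @` setT)).
  move=> D [x [r [r0 Pn ->]]].
  have iP : nbhd_of delta (circle x r) \in fset_set P by rewrite in_fset_set// inE.
  exists [` iP]%fset => //.
  have := valIE [` iP]%fset; rewrite /= => /esym e.
  by have [-> ->] := nbhd_circle_inj d0 (ltW (rad0 _)) (ltW r0) e.
exact: finite_image.
Qed.

Let boundT : spacing_bound alpha TT delta K.
Proof. by have [] := spacing_const_least finT alpha0 d0. Qed.
Let boundP : spacing_bound beta (Phi delta P) delta Kc.
Proof. by have [] := spacing_const_least finPhi beta0 d0. Qed.

Let K0 : 0 <= K.
Proof.
have := boundT 0 (lexx delta); rewrite divff ?gt_eqF// powR1 mulr1.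
by apply: le_trans; exact: ler0n.
Qed.
Let Kc0 : 0 <= Kc.
Proof.
have := boundP 0 (lexx delta); rewrite divff ?gt_eqF// powR1 mulr1.
by apply: le_trans; exact: ler0n.
Qed.

Let double (k : nat) (c rho gamma : R) : 0 <= c -> delta <= rho -> gamma <= k%:R ->
  c * (2 * rho / delta) `^ gamma <= 2 ^+ k * c * (rho / delta) `^ gamma.
Proof.
move=> c0 dr gk; have r0 : 0 <= rho / delta by rewrite divr_ge0 ?(ltW d0)// (le_trans (ltW d0)).
rewrite -mulrA powRM// [2 ^+ k * c]mulrC -mulrA; apply: ler_wpM2l => //.
apply: ler_wpM2r; first exact: powR_ge0.
by rewrite -powR_mulrn//; apply: ler_powR => //; rewrite ler1n.
Qed.

(** A box of half-side rho lies in the open Euclidean ball of radius 2 rho, since 2 < 2^2; doubling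
    the radius costs 2^2 because alpha <= 2. *)
Let discs_spaced rho c1 c2 : delta <= rho ->
  #|[set j : J | `|cy j 0 0 - c1| <= rho & `|cy j 0 1 - c2| <= rho]%SET|%:R
    <= 2 ^+ 2 * K * (rho / delta) `^ alpha.
Proof.
move=> dr; have r0 : 0 < rho by apply: lt_le_trans dr.
have dr2 : delta <= 2 * rho by apply: le_trans dr _; rewrite ler_peMl ?(ltW r0)// ler1n.
apply: le_trans (double K0 dr alpha2).
pose c : 'rV[R]_2 := \row_(k < 2) (if k == 0 then c1 else c2).
apply: le_trans (boundT c dr2).
apply: (@card_le_realcard R _ _ _ val).
- by apply: sub_finite_set finT => D [].
- by move=> j j' _ _; exact: val_inj.
move=> j; rewrite inE => /andP[h1 h2]; split; first exact: valJP.
exists (cy j); split; first by rewrite valJE.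
rewrite /eball /= -(@ltr_pXn2r _ 2)// ?nnegrE ?enorm_ge0 ?mulr_ge0 ?(ltW r0)//.
rewrite enorm_sqr big_ord_recl big_ord1 !mxE /=.
have -> : lift ord0 ord0 = 1 :> 'I_2 by apply/val_inj.
have sq (x : R) : `|x| <= rho -> x ^+ 2 <= rho ^+ 2.
  by move=> h; rewrite -(real_normK (num_real x)); apply: lerXn2r; rewrite ?nnegrE// ltW.
have s1 := sq _ h1; have s2 := sq _ h2.
have rr : 0 < rho ^+ 2 by rewrite exprn_gt0.
rewrite exprMn -natrX; apply: le_lt_trans (lerD s1 s2) _.
by rewrite -mulr2n -[_ *+ 2]mulr_natl ltr_pM2r// ltr_nat.
Qed.

(** The same comparison in dimension three, where 3 < 2^2 and doubling costs 2^3. The spacing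
    constant counts balls of [Phi], so distinct circles must also be shown to have distinct
    balls. *)
Let circles_spaced rho c1 c2 c3 : delta <= rho ->
  #|[set i : I | [&& `|cx i 0 0 - c1| <= rho, `|cx i 0 1 - c2| <= rho & `|rad i - c3| <= rho]]%SET|%:R
    <= 2 ^+ 3 * Kc * (rho / delta) `^ beta.
Proof.
move=> dr; have r0 : 0 < rho by apply: lt_le_trans dr.
have dr2 : delta <= 2 * rho by apply: le_trans dr _; rewrite ler_peMl ?(ltW r0)// ler1n.
apply: le_trans (double Kc0 dr beta3).
pose c : 'rV[R]_(2 + 1) := row_mx (\row_(k < 2) (if k == 0 then c1 else c2)) c3%:M.
apply: le_trans (boundP c dr2).
apply: (@card_le_realcard R _ _ _ (fun i => eball (row_mx (cx i) (rad i)%:M) delta)).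
- by apply: sub_finite_set finPhi => D [].
- move=> i i' _ _ e; apply: val_inj; rewrite !valIE.
  have e' : row_mx (cx i) (rad i)%:M = row_mx (cx i') (rad i')%:M.
    by apply: eball_center d0 _; rewrite e.
  have [-> /matrixP/(_ 0 0)] := eq_row_mx e'.
  by rewrite !mxE eqxx !mulr1n => ->.
move=> i; rewrite inE => /and3P[h1 h2 h3]; split; first exact: PhiE.
exists (row_mx (cx i) (rad i)%:M); split; first exact: self_ball.
rewrite /eball /= -(@ltr_pXn2r _ 2)// ?nnegrE ?enorm_ge0 ?mulr_ge0 ?(ltW r0)//.
rewrite enorm_sqr big_split_ord /= big_ord1 big_ord_recl big_ord1.
rewrite opp_row_mx add_row_mx !row_mxEl row_mxEr !mxE /=.
have -> : lift ord0 ord0 = 1 :> 'I_2 by apply/val_inj.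
rewrite ?eqxx ?mulr1n.
have sq (x : R) : `|x| <= rho -> x ^+ 2 <= rho ^+ 2.
  by move=> h; rewrite -(real_normK (num_real x)); apply: lerXn2r; rewrite ?nnegrE// ltW.
have s1 := sq _ h1; have s2 := sq _ h2; have s3 := sq _ h3.
have rr : 0 < rho ^+ 2 by rewrite exprn_gt0.
rewrite exprMn -natrX; apply: le_lt_trans (lerD (lerD s1 s2) s3) _.
have -> : rho ^+ 2 + rho ^+ 2 + rho ^+ 2 = 3%:R * rho ^+ 2 by ring.
by rewrite ltr_pM2r// ltr_nat.
Qed.

Let inc (i : I) (j : J) : bool := `[< val i `&` val j !=set0 >].

Let incP i j : inc i j ->
  [/\ `|(cx i 0 0 - cy j 0 0) ^+ 2 + (cx i 0 1 - cy j 0 1) ^+ 2 - rad i ^+ 2| <= 12 * delta,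
      `|cx i 0 0 - cy j 0 0| <= 4 & `|cx i 0 1 - cy j 0 1| <= 4].
Proof.
move/asboolP; rewrite valIE valJE; have /andP[h1 h2] := radP i.
by apply: nbhd_circle_meets_eball => //; exact: ltW.
Qed.

Let incidences_le : incidences P TT <= \sum_(i : I) \sum_(j : J) (inc i j)%:R.
Proof.
have -> : \sum_(i : I) \sum_(j : J) (inc i j)%:R = #|[set ij : I * J | inc ij.1 ij.2]%SET|%:R :> R.
  rewrite -sum1_card natr_sum [RHS]big_mkcond /= sum_pair.
  by apply: eq_bigr => i _; apply: eq_bigr => j _; rewrite inE; case: (inc i j).
apply: (@realcard_le_card R _ _ _ (fun ij : I * J => (val ij.1, val ij.2))).
  apply: (@sub_finite_set _ _ (P `*` TT)); first by move=> [B D] [].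
  exact: finite_setX.
move=> [B D] [/= PB TD BD].
have iP : B \in fset_set P by rewrite in_fset_set// inE.
have jP : D \in fset_set TT by rewrite in_fset_set// inE.
by exists ([` iP]%fset, [` jP]%fset) => //; rewrite inE; apply/asboolP.
Qed.

Lemma incidences_trivial : incidences P TT <= realcard R P * realcard R TT.
Proof.
apply: le_trans incidences_le _; rewrite cardI cardJ mulr_natl -sumr_const.
apply: ler_sum => i _; rewrite -sumr_const; apply: ler_sum => j _.
by rewrite -[leRHS]/(1%:R) ler_nat leq_b1.
Qed.

Lemma spacing_const_ge0 : 0 <= K. Proof. exact: K0. Qed.
Lemma circle_spacing_const_ge0 : 0 <= Kc. Proof. exact: Kc0. Qed.

(** A member is counted in the box around its own centre. Positivity is wanted because the balancing
    scale is obtained by dividing by the square root of X. *)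
Lemma spacing_const_gt0 : 0 < realcard R TT -> 0 < K.
Proof.
rewrite cardJ ltr0n => /card_gt0P[j _].
have := discs_spaced (cy j 0 0) (cy j 0 1) (lexx delta).
rewrite divff ?gt_eqF// powR1 mulr1 => h.
rewrite -(@pmulr_rgt0 _ (2 ^+ 2)) ?exprn_gt0//; apply: lt_le_trans h.
by rewrite ltr0n; apply/card_gt0P; exists j; rewrite inE !subrr normr0 ltW.
Qed.

Lemma circle_spacing_const_gt0 : 0 < realcard R P -> 0 < Kc.
Proof.
rewrite cardI ltr0n => /card_gt0P[i _].
have := circles_spaced (cx i 0 0) (cx i 0 1) (rad i) (lexx delta).
rewrite divff ?gt_eqF// powR1 mulr1 => h.
rewrite -(@pmulr_rgt0 _ (2 ^+ 3)) ?exprn_gt0//; apply: lt_le_trans h.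
by rewrite ltr0n; apply/card_gt0P; exists i; rewrite inE !subrr normr0 ltW.
Qed.

Lemma incidences_multiscale :
  multiscale_bound (incidences P TT) (realcard R P * realcard R TT)
    (2 ^+ 2 * K * (2 ^+ 3 * Kc) * (realcard R P * realcard R TT)) delta ((alpha + beta) / 2).
Proof.
move=> D k eps Z q D0 e0 qE q300 hK hZ Z0.
apply: le_trans incidences_le _; rewrite cardI cardJ.
have A0 : 0 <= 2 ^+ 2 * K by rewrite mulr_ge0 ?exprn_ge0.
have B0 : 0 <= 2 ^+ 3 * Kc by rewrite mulr_ge0 ?exprn_ge0.
exact: (multiscale_incidences d0 d1 radP beta0 beta3 A0 B0 discs_spaced circles_spaced incP
  alpha0 alpha2 D0 e0 qE q300 hK hZ Z0).
Qed.
End Families.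

(** * Choice of the scale ratio and conclusion in the two regimes *)

Lemma scale_ratio_exists (R : realType) (eps : R) : 0 < eps ->
  exists2 D : nat, (0 < D)%N & 300 <= (300 * D%:R) `^ eps.
Proof.
move=> e0; pose n := (Num.truncn (300 `^ eps^-1 : R)).+1; exists n => //.
have hn : 300 `^ eps^-1 <= n%:R :> R by apply/ltW; exact: truncnS_gt.
have h3 : 0 <= 300 :> R by rewrite ler0n.
have h3n : 0 <= 300 * n%:R :> R by rewrite -natrM ler0n.
apply: (@le_trans _ _ ((300 `^ eps^-1) `^ eps)).
  by rewrite -powRrM mulVf ?powRr1// gt_eqF.
have h : 300 `^ eps^-1 <= 300 * n%:R :> R.
  by apply: le_trans hn _; rewrite ler_peMl ?ler0n ?ler1n.
apply: (ge0_ler_powR (ltW e0)); last exact: h.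
  by rewrite nnegrE; exact: powR_ge0.
by rewrite nnegrE.
Qed.

Theorem theorem2p6 (R : realType) (alpha beta : R)
    (hbeta0 : 0 <= beta) (hbeta3 : beta <= 3)
    (halpha0 : 0 <= alpha) (halpha2 : alpha <= 2) :
  (alpha + beta <= 4 ->
    forall eps : R, 0 < eps ->
    exists C : R,
    forall (delta : R) (P TT : set (set 'rV[R]_2)),
      0 < delta -> delta < 1 ->
      finite_set P -> circle_nbhd_family delta P ->
      finite_set TT -> ball_family delta TT ->
      incidences P TT <=
        C * delta `^ (- eps) * delta `^ (- 1)
          * circle_spacing_const beta P delta `^ (1 / 2)
          * spacing_const alpha TT delta `^ (1 / 2)
          * realcard R P `^ (1 / 2) * realcard R TT `^ (1 / 2))
  /\
  (4 < alpha + beta ->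
    let lambda := 1 / (alpha + beta - 2) in
    lambda < 1 / 2 /\
    forall eps : R, 0 < eps ->
    exists C : R,
    forall (delta : R) (P TT : set (set 'rV[R]_2)),
      0 < delta -> delta < 1 ->
      finite_set P -> circle_nbhd_family delta P ->
      finite_set TT -> ball_family delta TT ->
      incidences P TT <=
        C * delta `^ (- eps) * delta `^ (- 2 * lambda)
          * circle_spacing_const beta P delta `^ lambda
          * spacing_const alpha TT delta `^ lambda
          * realcard R P `^ (1 - lambda) * realcard R TT `^ (1 - lambda)).
Proof.
split.
  move=> ab4 eps e0.
  have e3 : 0 < eps / 3 by rewrite divr_gt0.
  have [D D0 De] := scale_ratio_exists e3.
  (* The last factor is the price of passing from Euclidean balls to boxes for discs and circles;
     eps / 3 compensates the exponent 3 eps of the optimised bounds. *)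
  exists ((low_const D (eps / 3) + high_const D (eps / 3)) * (2 ^+ 2 * 2 ^+ 3) `^ (1 / 2)).
  move=> delta P TT d0 d1 finP famP finT famT.
  have H := incidences_multiscale hbeta0 hbeta3 halpha0 halpha2 d0 d1 finP famP finT famT.
  have K0 := spacing_const_ge0 halpha0 d0 finT.
  have Kc0 := circle_spacing_const_ge0 hbeta0 d0 finP famP.
  have p0 : 0 <= realcard R P by exact: ler0n.
  have t0 : 0 <= realcard R TT by exact: ler0n.
  set Kc := circle_spacing_const beta P delta in H Kc0 *.
  set K := spacing_const alpha TT delta in H K0 *.
  set X := _ * _ * (realcard R P * realcard R TT) in H.
  have pt0 := mulr_ge0 p0 t0.
  have X0 : 0 <= X by rewrite !mulr_ge0 ?exprn_ge0.
  have sg2 : (alpha + beta) / 2 <= 2 by lra.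
  apply: le_trans (sparse_bound H d0 d1 pt0 D0 e3 De sg2) _.
  have -> : 3 * (eps / 3) = eps by field.
  rewrite le_eqVlt; apply/orP; left; apply/eqP.
  rewrite powR_inv1 ?(ltW d0)// -[Num.sqrt X]powR12_sqrt// [1 / 2]mul1r.
  have -> : X = (2 ^+ 2 * 2 ^+ 3) * (Kc * (K * (realcard R P * realcard R TT))) by rewrite /X; ring.
  rewrite powRM ?mulr_ge0 ?exprn_ge0// [(Kc * _) `^ _]powRM ?mulr_ge0//.
  rewrite [(K * _) `^ _]powRM// [(realcard R P * _) `^ _]powRM//.
  by ring.
move=> ab4 lambda; split.
  by rewrite /lambda ltr_pdivrMr; lra.
move=> eps e0.
have e3 : 0 < eps / 3 by rewrite divr_gt0.
have [D D0 De] := scale_ratio_exists e3.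
exists ((low_const D (eps / 3) + high_const D (eps / 3)) * (2 ^+ 2 * 2 ^+ 3) `^ lambda).
move=> delta P TT d0 d1 finP famP finT famT.
have H := incidences_multiscale hbeta0 hbeta3 halpha0 halpha2 d0 d1 finP famP finT famT.
have K0 := spacing_const_ge0 halpha0 d0 finT.
have Kc0 := circle_spacing_const_ge0 hbeta0 d0 finP famP.
have Kp := spacing_const_gt0 halpha0 halpha2 d0 finT famT.
have Kcp := circle_spacing_const_gt0 hbeta0 hbeta3 d0 finP famP.
have Np := incidences_trivial finP finT.
have p0 : 0 <= realcard R P by exact: ler0n.
have t0 : 0 <= realcard R TT by exact: ler0n.
set Kc := circle_spacing_const beta P delta in H Kc0 Kcp *.
set K := spacing_const alpha TT delta in H K0 Kp *.
set X := _ * _ * (realcard R P * realcard R TT) in H.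
have pt0 := mulr_ge0 p0 t0.
have LC0 := bound_consts_ge0 (eps / 3) D0.
(* The balancing argument requires p and X to be positive; if one family is empty there are no
   incidences. *)
have [ptz|ptp] := eqVneq (realcard R P * realcard R TT) 0.
  have e : incidences P TT <= 0 by move: Np; rewrite ptz.
  apply: le_trans e _.
  by rewrite !mulr_ge0 ?powR_ge0.
have pp : 0 < realcard R P by rewrite lt0r p0 andbT; apply: contraNneq ptp => ->; rewrite mul0r.
have tp : 0 < realcard R TT by rewrite lt0r t0 andbT; apply: contraNneq ptp => ->; rewrite mulr0.
have ptp' : 0 < realcard R P * realcard R TT by rewrite mulr_gt0.
have Xp : 0 < X.
  by rewrite /X mulr_gt0// mulr_gt0// mulr_gt0 ?exprn_gt0 ?Kp ?Kcp.
have lamE : lambda = 1 / (2 * ((alpha + beta) / 2) - 2).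
  by rewrite /lambda; congr (_ / _); field.
have sg2 : 2 < (alpha + beta) / 2 by lra.
apply: le_trans (dense_bound H d0 d1 (ltW Xp) pt0 D0 e3 De lamE sg2 ptp' Xp Np) _.
have -> : 3 * (eps / 3) = eps by field.
rewrite le_eqVlt; apply/orP; left; apply/eqP.
have XE : X = (2 ^+ 2 * 2 ^+ 3) * (Kc * (K * (realcard R P * realcard R TT))) by rewrite /X; ring.
have pE : (realcard R P * realcard R TT) `^ lambda * (realcard R P * realcard R TT) `^ (1 - 2 * lambda)
   = realcard R P `^ (1 - lambda) * realcard R TT `^ (1 - lambda).
  rewrite -powRD ?ptp ?implybT// -powRM//; congr (_ `^ _); ring.
rewrite XE powRM ?mulr_ge0 ?exprn_ge0// [(Kc * _) `^ _]powRM ?mulr_ge0// [(K * _) `^ _]powRM//.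
rewrite -!mulrA -pE; ring.
Qed.
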